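(* Let $d\ge 3$ and $\alpha\in\mathbb{R}$. Let $A:S^1\to\mathrm{SL}_d(\mathbb{R})$ be continuous, regarded as a discrete-time cocycle in $\mathrm{SL}_d(\mathbb{R})$ over the circle rotation by $\alpha$. Then there is a continuous-time cocycle $\Phi$ in $\mathrm{SL}_d(\mathbb{R})$ over the suspension flow by $\frac12\alpha$ that satisfies $$\Phi^n_{(\theta,0)} = A^n_{2\theta},\qquad \forall n\in\mathbb{Z},$$ for all $\theta\in S^1$.
   Context: The circle $S^1$ is $[0,1]$ with endpoints identified (i.e. $\mathbb{R}/\mathbb{Z}$); $2\theta$ is taken mod $1$. The circle rotation by $\beta\in\mathbb{R}$ is $\phi:S^1\to S^1$, $\phi(\theta)=\theta+\beta \bmod 1$. Discrete-time cocycle over the rotation $\phi$ by $\alpha$: for continuous $A:S^1\to\mathrm{SL}_d(\mathbb{R})$, $\theta\mapsto A_\theta$, the $n$-step map ($n\in\mathbb{Z}$) is $A^n_\theta = A_{\phi^{n-1}\theta}\cdots A_{\phi\theta}A_\theta$ for $n>0$, $A^0_\theta=\mathrm{Id}$, and $A^n_\theta = A^{-1}_{\phi^{n}\theta}\cdots A^{-1}_{\phi^{-2}\theta}A^{-1}_{\phi^{-1}\theta}$ for $n<0$ (so $A^n_\theta$ is never the matrix power). Here $A^n_{2\theta}$ denotes the $n$-step map, with respect to the rotation by $\alpha$, at the point $2\theta$. Suspension flow by $\beta\in\mathbb{R}$: on the mapping torus $\Theta_1=(S^1\times[0,1])/\sim$ with $(\theta,1)\sim(\theta+\beta \bmod 1,0)$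 and the quotient topology, it is the flow $\phi^t(\theta,r) = (\theta+\lfloor r+t\rfloor\beta,\ r+t) \bmod 1$, $t\in\mathbb{R}$. Continuous-time cocycle in $\mathrm{SL}_d(\mathbb{R})$ over a suspension flow $\phi^t$: the map $\Phi:\Theta_1\times\mathbb{R}\to\mathrm{SL}_d(\mathbb{R})$, $((\theta,r),t)\mapsto\Phi^t_{(\theta,r)}$, generated by a continuous map $G:\Theta_1\to\mathfrak{sl}_d(\mathbb{R})$ (real trace-zero $d\times d$ matrices), i.e. the unique solution of $\Phi^0_{(\theta,r)}=\mathrm{Id}$, $\partial_t\Phi^t_{(\theta,r)} = G(\phi^t(\theta,r))\,\Phi^t_{(\theta,r)}$. *)

(* Defs.v *)
From HB Require Import structures.
From mathcomp Require Import all_boot all_order all_algebra.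
From mathcomp Require Import generic_quotient archimedean.
From mathcomp Require Import all_classical all_reals all_analysis.

Set Implicit Arguments.
Unset Strict Implicit.
Unset Printing Implicit Defensive.

Import Order.TTheory GRing.Theory Num.Theory.
Import numFieldNormedType.Exports.

Local Open Scope classical_set_scope.
Local Open Scope ring_scope.
Local Open Scope quotient_scope.

Section circle.
Context {R : realType}.
Implicit Types x y : R.

Definition circle_rel_def x y : bool := x - y \is a Num.int.

Lemma circle_rel_refl : reflexive circle_rel_def.
Proof. by move=> x; rewrite /circle_rel_def subrr rpred0. Qed.

Lemma circle_rel_sym : symmetric circle_rel_def.
Proof. by move=> x y; rewrite /circle_rel_def -opprB rpredN. Qed.

Lemma circle_rel_trans : transitive circle_rel_def.
Proof.
move=> y x z; rewrite /circle_rel_def => xy yz.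
by rewrite -(subrKA y) rpredD.
Qed.

Definition circle_rel :=
  EquivRel circle_rel_def circle_rel_refl circle_rel_sym circle_rel_trans.

End circle.

Definition circle (R : realType) := {eq_quot (@circle_rel R)}.

HB.instance Definition _ (R : realType) :=
  Topological.copy (circle R) (quotient_topology (circle R)).
HB.instance Definition _ (R : realType) := Quotient.on (circle R).

Section circle_maps.
Context {R : realType}.
Implicit Types (b x y : R) (p : circle R).

Definition circle_rot b p : circle R := \pi_(circle R) (repr p + b).

Definition circle_double p : circle R := \pi_(circle R) (2 * repr p).

Lemma circle_eqP x y :
  reflect (\pi_(circle R) x = \pi_(circle R) y) (x - y \is a Num.int).
Proof. exact: (@eqmodP _ (@circle_rel R)). Qed.

Lemma circle_rot_pi b x :
  circle_rot b (\pi_(circle R) x) = \pi_(circle R) (x + b).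
Proof.
apply/circle_eqP; rewrite opprD addrACA subrr addr0.
by apply/circle_eqP; rewrite reprK.
Qed.

Lemma circle_double_pi x :
  circle_double (\pi_(circle R) x) = \pi_(circle R) (2 * x).
Proof.
apply/circle_eqP; rewrite -mulrBr rpredM//; first exact: rpred_nat.
by apply/circle_eqP; rewrite reprK.
Qed.

Lemma circle_rotD b c p : circle_rot c (circle_rot b p) = circle_rot (b + c) p.
Proof. by rewrite -[p]reprK (circle_rot_pi b) !circle_rot_pi addrA. Qed.

Lemma circle_rot0 p : circle_rot 0 p = p.
Proof. by rewrite -[p]reprK circle_rot_pi addr0. Qed.

Lemma circle_rot_inj b : injective (circle_rot b).
Proof.
apply: (can_inj (g := circle_rot (- b))) => p.
by rewrite circle_rotD subrr circle_rot0.
Qed.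

End circle_maps.

(* The mapping torus (S^1 x [0,1]) / ((theta,1) ~ (theta + b, 0)), with the   *)
(* quotient topology; [0,1] is a type carrying the subspace topology.         *)
Definition unit_itv (R : realType) : set R := `[0, 1].
Arguments unit_itv : clear implicits.

Definition cylinder (R : realType) := (circle R * unit_itv R)%type.

HB.instance Definition _ (R : realType) := Topological.on (cylinder R).

Section torus.
Context {R : realType}.
Variable b : R.
Implicit Types u v : cylinder R.

Definition torus_glue u v : bool :=
  [&& \val u.2 == 1, \val v.2 == 0 & v.1 == circle_rot b u.1].

Definition torus_rel_def u v : bool :=
  [|| u == v, torus_glue u v | torus_glue v u].

Lemma torus_rel_refl : reflexive torus_rel_def.
Proof. by move=> u; rewrite /torus_rel_def eqxx. Qed.

Lemma torus_rel_sym : symmetric torus_rel_def.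
Proof.
by move=> u v; rewrite /torus_rel_def eq_sym (orbC (torus_glue u v)).
Qed.

Lemma torus_rel_trans : transitive torus_rel_def.
Proof.
move=> v u w /or3P[/eqP->//|uv|vu] /or3P[/eqP<-|vw|wv].
- by rewrite /torus_rel_def uv orbT.
- case/and3P: uv => _ /eqP v0 _; case/and3P: vw => /eqP v1 _ _.
  by move: v1; rewrite v0 => /eqP; rewrite eq_sym oner_eq0.
- case/and3P: uv => /eqP u1 _ /eqP vu; case/and3P: wv => /eqP w1 _ /eqP vw.
  apply/or3P/Or31/eqP; case: u w u1 w1 vu vw => [p r] [q s] /= r1 s1 ->.
  by move=> /circle_rot_inj ->; congr pair; apply: val_inj; rewrite /= r1.
- by rewrite /torus_rel_def vu !orbT.
- case/and3P: vu => _ /eqP u0 /eqP uv; case/and3P: vw => _ /eqP w0 /eqP wv.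
  apply/or3P/Or31/eqP; case: u w u0 w0 uv wv => [p r] [q s] /= r0 s0 -> ->.
  by congr pair; apply: val_inj; rewrite /= r0.
- case/and3P: vu => /eqP v1 _ _; case/and3P: wv => _ /eqP v0 _.
  by move: v1; rewrite v0 => /eqP; rewrite eq_sym oner_eq0.
Qed.

Definition torus_rel :=
  EquivRel torus_rel_def torus_rel_refl torus_rel_sym torus_rel_trans.

End torus.

Definition torus (R : realType) (b : R) := {eq_quot (torus_rel b)}.

HB.instance Definition _ (R : realType) (b : R) :=
  Topological.copy (torus b) (quotient_topology (torus b)).
HB.instance Definition _ (R : realType) (b : R) := Quotient.on (torus b).

Section suspension.
Context {R : realType}.

Lemma itv0_proof : (0 : R) \in unit_itv R.
Proof. by rewrite inE /unit_itv /= in_itv /= lexx ler01. Qed.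

Definition itv0 : unit_itv R := exist _ 0 itv0_proof.

Lemma itv_frac_proof (s : R) : s - (Num.floor s)%:~R \in unit_itv R.
Proof.
rewrite inE /unit_itv /= in_itv /= subr_ge0 floor_le /=.
by rewrite lerBlDl -intrD1 ltW// floorD1_gt.
Qed.

Definition itv_frac (s : R) : unit_itv R :=
  exist (fun x => x \in unit_itv R) _ (itv_frac_proof s).

Variable b : R.

Definition base_pt (p : circle R) : torus b := \pi_(torus b) (p, itv0).

Definition susp_cyl (t : R) (u : cylinder R) : cylinder R :=
  (circle_rot ((Num.floor (\val u.2 + t))%:~R * b) u.1,
   itv_frac (\val u.2 + t)).

Definition susp_flow (t : R) (x : torus b) : torus b :=
  \pi_(torus b) (susp_cyl t (repr x)).

Lemma susp_cyl_glue t u v : torus_glue b u v -> susp_cyl t u = susp_cyl t v.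
Proof.
case: u v => [p r] [q s] /and3P[/= /eqP r1 /eqP s0 /eqP ->].
have fl : Num.floor (1 + t) = 1 + Num.floor t.
  by rewrite floorDzr ?floor1 ?rpred1.
rewrite /susp_cyl /= r1 s0 add0r circle_rotD; congr pair.
  by rewrite fl intrD mulrDl mul1r.
by apply: val_inj; rewrite /= fl intrD opprD addrACA subrr add0r.
Qed.

Lemma susp_flow_pi t u :
  susp_flow t (\pi_(torus b) u) = \pi_(torus b) (susp_cyl t u).
Proof.
rewrite /susp_flow; congr (\pi_(torus b) _).
have /(@eqmodP _ (torus_rel b))/or3P[/eqP->//|h|h] :
  repr (\pi_(torus b) u) = u %[mod torus b] by rewrite reprK.
- exact: susp_cyl_glue.
- exact/esym/susp_cyl_glue.
Qed.

End suspension.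

Section cocycles.
Context {R : realType} {d : nat}.

Section discrete.
Variables (a : R) (A : circle R -> 'M[R]_d).

Fixpoint fwd_steps (n : nat) (p : circle R) : 'M[R]_d :=
  if n is m.+1 then A (iter m (circle_rot a) p) *m fwd_steps m p else 1%:M.

Fixpoint bwd_steps (n : nat) (p : circle R) : 'M[R]_d :=
  if n is m.+1 then invmx (A (iter n (circle_rot (- a)) p)) *m bwd_steps m p
  else 1%:M.

(* [Negz m] is the integer - m.+1. *)
Definition nstep_map (n : int) (p : circle R) : 'M[R]_d :=
  match n with
  | Posz m => fwd_steps m p
  | Negz m => bwd_steps m.+1 p
  end.

End discrete.

Definition generated_by (b : R) (G : torus b -> 'M[R]_d)
    (Phi : torus b -> R -> 'M[R]_d) : Prop :=
  forall x, Phi x 0 = 1%:M /\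
    forall t : R, is_derive t (1 : R) (Phi x) (G (susp_flow t x) *m Phi x t).

(* [generated_by] determines [Phi] by uniqueness for linear ODEs; that [Phi]  *)
(* is SL_d-valued and G is sl_d-valued is expressed by \det and \tr.           *)
Definition SL_flow_cocycle (b : R) (Phi : torus b -> R -> 'M[R]_d) : Prop :=
  (forall x t, \det (Phi x t) = 1) /\
  exists G : torus b -> 'M[R]_d,
    [/\ continuous G, forall x, \tr (G x) = 0 & generated_by G Phi].

End cocycles.

(* Main.v *)
(* Write [B theta = A (2 theta)]. It suffices to join the loop [B] to [1] by  *)
(* a path [F (theta, t)] of loops in SL_d, C^1 in [t], constant for [t <= 0]  *)
(* and for [1 <= t]: the pieces [F (theta + n alpha / 2, t - n)] then glue    *)
(* along the suspension flow, and [G = F' F^-1] descends to the mapping torus *)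
(* because it vanishes at both ends; it is trace-free by Jacobi's formula.    *)
(* Homotopies are taken in GL_d^+, through 1-periodic loops on the line. For  *)
(* [d >= 3] the first column of a loop is replaced by a piecewise linear one, *)
(* which misses some direction; this lets shears bring it to the first basis  *)
(* vector, so every loop is homotopic to [diag (1, A')], and inductively to a *)
(* loop [z] of similarities of a plane. Now [z (2 theta)] is homotopic to [z  *)
(* ^ 2], and a third dimension allows conjugating [z] to its complex          *)
(* conjugate, so that [z ^ 2] is homotopic to [z * conj z], hence to [1].     *)
(* Finally, a merely continuous homotopy is subdivided in time and replaced   *)
(* by a product of segments, normalized by the determinant and                *)
(* reparametrized.                                                            *)

(* The group SL_d retracts onto SO(d), whose fundamental group has order two for [d >= 3], so a loop
   becomes contractible once its argument is doubled. The rotation by half of [alpha] on theta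
   covers the rotation by [alpha] on 2 theta, so a contraction of [A (2 theta)] can be run once per
   unit of suspension time: during the n-th turn it supplies the next factor of the discrete
   product.

   No fundamental group is computed. [homotopic_reduce] splits off one dimension at a time,
   [homotopic_rho_double1] contracts the doubled loop that remains in dimension three, and
   [homotopic_double1] combines them by induction. [homotopic_isotopic1] and [flat_isotopyP] turn
   the contraction into one in SL_d that is C^1 in time with derivative zero at both ends.
   [long_map_derivative] shows that the glued pieces solve the linear equation,
   [flow_gen_continuous] that the generator is continuous on the torus, and [flow_map_int] compares
   integer times with the discrete cocycle. *)
From HB Require Import structures.
Require Import Defs.
From mathcomp Require Import all_boot all_order all_fingroup all_algebra.
From mathcomp Require Import generic_quotient archimedean.
From mathcomp Require Import all_classical all_reals all_analysis.
From mathcomp Require Import ring lra zify.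
Import numFieldNormedType.Exports.
Import Order.TTheory GRing.Theory Num.Theory.

Set Implicit Arguments.
Unset Strict Implicit.
Unset Printing Implicit Defensive.

Local Open Scope classical_set_scope.
Local Open Scope ring_scope.

(** * Entrywise continuity of matrix-valued maps *)

Section entrywise_continuity.
Context {R : realType} {T : topologicalType}.

Lemma continuous_cst (a : R) : continuous (fun _ : T => a).
Proof. by move=> x; exact: cvg_cst. Qed.

Lemma continuous_add (f g : T -> R) :
  continuous f -> continuous g -> continuous (fun x => f x + g x).
Proof. by move=> cf cg x; exact: (cvgD (cf x) (cg x)). Qed.

Lemma continuous_opp (f : T -> R) : continuous f -> continuous (fun x => - f x).
Proof. by move=> cf x; exact: (cvgN (cf x)). Qed.

Lemma continuous_mul (f g : T -> R) :
  continuous f -> continuous g -> continuous (fun x => f x * g x).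
Proof. by move=> cf cg x; exact: (cvgM (cf x) (cg x)). Qed.

Lemma continuous_inv (f : T -> R) :
  (forall x, f x != 0) -> continuous f -> continuous (fun x => (f x)^-1).
Proof. by move=> f0 cf x; exact: (cvgV (f0 x) (cf x)). Qed.

Lemma continuous_sum (I : Type) (r : seq I) (P : pred I) (F : I -> T -> R) :
  (forall i, P i -> continuous (F i)) ->
  continuous (fun x => \sum_(i <- r | P i) F i x).
Proof.
move=> cF; elim: r => [|i r IH].
  by under eq_fun do rewrite big_nil; exact: continuous_cst.
under eq_fun do rewrite big_cons.
by case: (P i) (cF i) => [/(_ isT) cFi|//]; exact: continuous_add.
Qed.

Lemma continuous_prod (I : Type) (r : seq I) (P : pred I) (F : I -> T -> R) :
  (forall i, P i -> continuous (F i)) ->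
  continuous (fun x => \prod_(i <- r | P i) F i x).
Proof.
move=> cF; elim: r => [|i r IH].
  by under eq_fun do rewrite big_nil; exact: continuous_cst.
under eq_fun do rewrite big_cons.
by case: (P i) (cF i) => [/(_ isT) cFi|//]; exact: continuous_mul.
Qed.

Definition mxcont m n (F : T -> 'M[R]_(m, n)) :=
  forall i j, continuous (fun x => F x i j).

Lemma mxcont_cst m n (M : 'M[R]_(m, n)) : mxcont (fun _ => M).
Proof. by move=> i j; exact: continuous_cst. Qed.

Lemma mxcont_add m n (F G : T -> 'M[R]_(m, n)) :
  mxcont F -> mxcont G -> mxcont (fun x => F x + G x).
Proof.
move=> cF cG i j; under eq_fun do rewrite mxE.
exact: continuous_add.
Qed.

Lemma mxcont_scale m n (f : T -> R) (F : T -> 'M[R]_(m, n)) :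
  continuous f -> mxcont F -> mxcont (fun x => f x *: F x).
Proof.
move=> cf cF i j; under eq_fun do rewrite mxE.
exact: continuous_mul.
Qed.

Lemma mxcont_mul m n p (F : T -> 'M[R]_(m, n)) (G : T -> 'M[R]_(n, p)) :
  mxcont F -> mxcont G -> mxcont (fun x => F x *m G x).
Proof.
move=> cF cG i j; under eq_fun do rewrite mxE.
by apply: continuous_sum => k _; exact: continuous_mul.
Qed.

Lemma mxcont_tr m n (F : T -> 'M[R]_(m, n)) :
  mxcont F -> mxcont (fun x => (F x)^T).
Proof. by move=> cF i j; under eq_fun do rewrite mxE; exact: cF. Qed.

Lemma mxcont_block m1 m2 n1 n2 (F : T -> 'M[R]_(m1, n1))
    (G : T -> 'M[R]_(m1, n2)) (H : T -> 'M[R]_(m2, n1))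
    (K : T -> 'M[R]_(m2, n2)) :
  mxcont F -> mxcont G -> mxcont H -> mxcont K ->
  mxcont (fun x => block_mx (F x) (G x) (H x) (K x)).
Proof.
move=> cF cG cH cK i j.
case: (split_ordP i) => k ->; case: (split_ordP j) => l ->.
- by under eq_fun do rewrite block_mxEul; exact: cF.
- by under eq_fun do rewrite block_mxEur; exact: cG.
- by under eq_fun do rewrite block_mxEdl; exact: cH.
- by under eq_fun do rewrite block_mxEdr; exact: cK.
Qed.

Lemma continuous_det m (F : T -> 'M[R]_m) :
  mxcont F -> continuous (fun x => \det (F x)).
Proof.
move=> cF; apply: continuous_sum => s _.
apply: continuous_mul; first exact: continuous_cst.
by apply: continuous_prod => i _.
Qed.

Lemma continuous_cofactor m (F : T -> 'M[R]_m) i j :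
  mxcont F -> continuous (fun x => cofactor (F x) i j).
Proof.
move=> cF; apply: continuous_mul; first exact: continuous_cst.
apply: continuous_det => k l.
by under eq_fun do rewrite !mxE; exact: cF.
Qed.

(** Cramer's rule: the inverse is the adjugate divided by the determinant, both polynomial in the
    entries. *)
Lemma mxcont_inv m (F : T -> 'M[R]_m) :
  (forall x, 0 < \det (F x)) -> mxcont F -> mxcont (fun x => invmx (F x)).
Proof.
move=> dF cF.
have -> : (fun x => invmx (F x)) = (fun x => (\det (F x))^-1 *: \adj (F x)).
  apply: funext => x; rewrite /invmx ifT//.
  by rewrite unitmxE unitfE gt_eqF.
apply: mxcont_scale.
  by apply: continuous_inv; [move=> x; rewrite gt_eqF|exact: continuous_det].
by move=> i j; under eq_fun do rewrite mxE; exact: continuous_cofactor.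
Qed.

End entrywise_continuity.

Lemma mxcont_comp (R : realType) (S T : topologicalType) m n (g : S -> T)
    (F : T -> 'M[R]_(m, n)) :
  continuous g -> mxcont F -> mxcont (fun x => F (g x)).
Proof.
move=> cg cF i j x.
exact: (@continuous_comp _ _ _ g (fun x => F x i j) x (cg x) (cF i j (g x))).
Qed.

Lemma continuous_pairf (S T U : topologicalType) (f : S -> T) (g : S -> U) :
  continuous f -> continuous g -> continuous (fun x => (f x, g x)).
Proof. by move=> cf cg x; exact: (cvg_pair (cf x) (cg x)). Qed.

Lemma mxcontE (R : realType) (T : topologicalType) m n (F : T -> 'M[R]_(m, n)) :
  continuous F <-> mxcont F.
Proof.
split=> [cF i j x|cF x].
  exact: (@continuous_comp _ _ _ F (fun M => M i j) x (cF x)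
            (@coord_continuous R m n i j (F x))).
move=> A [P PF PA]; apply: filterS (PA : _ `<=` A) _.
apply: filter_forall => i; apply: filter_forall => j.
exact: (cF i j x (P i j) (PF i j)).
Qed.

(** * Homotopies of loops *)

Section homotopy.
Context {R : realType}.

Lemma continuous_fst (S T : topologicalType) : continuous (@fst S T).
Proof. by move=> x; exact: cvg_fst. Qed.

Lemma continuous_snd (S T : topologicalType) : continuous (@snd S T).
Proof. by move=> x; exact: cvg_snd. Qed.

Lemma continuous_id (T : topologicalType) : continuous (fun x : T => x).
Proof. by move=> x; exact: cvg_id. Qed.

Lemma periodicz (T : Type) (f : R -> T) : (forall x, f (x + 1) = f x) ->
  forall (k : int) x, f (x + k%:~R) = f x.
Proof.
move=> pf; have pn (n : nat) x : f (x + n%:R) = f x.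
  by elim: n => [|n IH]; rewrite ?addr0// -addn1 natrD addrA pf.
case=> n x; first exact: pn.
by rewrite NegzE rmorphN/= -[in RHS](subrK n.+1%:R x) pn.
Qed.

(** Positivity of the determinant is an open condition, so loops can be perturbed and joined by
    segments; determinant 1 is restored later by [normalize]. *)
Definition loop m (B : R -> 'M[R]_m) :=
  [/\ mxcont B, forall x, B (x + 1) = B x & forall x, 0 < \det (B x)].

Definition homotopic m (B C : R -> 'M[R]_m) :=
  exists F : R * R -> 'M[R]_m,
  [/\ mxcont F, forall x t, F (x + 1, t) = F (x, t),
      forall p, 0 < \det (F p), forall x, F (x, 0) = B x
    & forall x, F (x, 1) = C x].

(** A homotopy has all of the line as its time axis, which avoids subspace topologies; clipping time
    to the unit interval extends one that is invertible only there. *)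
Lemma homotopicP m (B C : R -> 'M[R]_m) (F : R * R -> 'M[R]_m) :
  mxcont F -> (forall x t, F (x + 1, t) = F (x, t)) ->
  (forall x t, 0 <= t <= 1 -> 0 < \det (F (x, t))) ->
  (forall x, F (x, 0) = B x) -> (forall x, F (x, 1) = C x) -> homotopic B C.
Proof.
move=> cF pF dF F0 F1.
pose clip (t : R) := Order.max 0 (Order.min t 1).
exists (fun p => F (p.1, clip p.2)); split.
- apply: mxcont_comp cF; apply: continuous_pairf; first exact: continuous_fst.
  move=> p; have cmin : {for p, continuous ((fun q : R * R => q.2) \min cst 1)}.
    by apply: continuous_min; [exact: continuous_snd|exact: cvg_cst].
  exact: (continuous_max (cvg_cst _) cmin).
- by move=> x t /=.
- move=> p; apply: dF; rewrite /clip le_max lexx/= ge_max ler01/=.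
  by rewrite ge_min lexx orbT.
- by move=> x; rewrite /= /clip min_l ?ler01// maxxx.
- by move=> x; rewrite /= /clip minxx max_r.
Qed.

Lemma homotopic_loopl m (B C : R -> 'M[R]_m) : homotopic B C -> loop B.
Proof.
case=> F [cF pF dF F0 F1]; split=> [|x|x].
- rewrite (_ : B = (fun x => F (x, 0))); last by apply/funext.
  apply: mxcont_comp cF; apply: continuous_pairf; first exact: continuous_id.
  by move=> x; exact: cvg_cst.
- by rewrite -!F0 pF.
- by rewrite -F0.
Qed.

Lemma homotopic_loopr m (B C : R -> 'M[R]_m) : homotopic B C -> loop C.
Proof.
case=> F [cF pF dF F0 F1]; split=> [|x|x].
- rewrite (_ : C = (fun x => F (x, 1))); last by apply/funext.
  apply: mxcont_comp cF; apply: continuous_pairf; first exact: continuous_id.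
  by move=> x; exact: cvg_cst.
- by rewrite -!F1 pF.
- by rewrite -F1.
Qed.

Lemma loop_fst m (B : R -> 'M[R]_m) :
  loop B -> mxcont (fun p : R * R => B p.1).
Proof. by case=> cB _ _; apply: mxcont_comp cB; exact: continuous_fst. Qed.

Lemma homotopic_refl m (B : R -> 'M[R]_m) : loop B -> homotopic B B.
Proof.
move=> lB; exists (fun p => B p.1); split=> //; first exact: loop_fst.
- by case: lB => _ pB _ x t /=.
- by case: lB.
Qed.

Lemma det_inv_gt0 m (M : 'M[R]_m) : 0 < \det M -> 0 < \det (invmx M).
Proof. by move=> M0; rewrite det_inv invr_gt0. Qed.

Lemma unitmx_det_gt0 m (M : 'M[R]_m) : 0 < \det M -> M \in unitmx.
Proof. by move=> M0; rewrite unitmxE unitfE gt_eqF. Qed.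

Lemma homotopic_sym m (B C : R -> 'M[R]_m) : homotopic B C -> homotopic C B.
Proof.
case=> F [cF pF dF F0 F1]; exists (fun p => F (p.1, 1 - p.2)); split=> //.
- apply: mxcont_comp cF; apply: continuous_pairf; first exact: continuous_fst.
  apply: continuous_add; first exact: continuous_cst.
  by apply: continuous_opp; exact: continuous_snd.
- by move=> x t /=.
- by move=> x /=; rewrite subr0.
- by move=> x /=; rewrite subrr.
Qed.

(* With homotopies [F] from [B] to [C] and [G] from [C] to [D], the pointwise *)
(* product [F C^-1 G] goes from [B] to [D]: no concatenation in time.         *)
Lemma homotopic_trans m (C B D : R -> 'M[R]_m) :
  homotopic B C -> homotopic C D -> homotopic B D.
Proof.
move=> /[dup] /homotopic_loopr lC [F [cF pF dF F0 F1]] [G [cG pG dG G0 G1]].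
have [_ pC dC] := lC.
exists (fun p => F p *m invmx (C p.1) *m G p); split.
- apply: mxcont_mul => //; apply: mxcont_mul => //.
  by apply: mxcont_inv => // *; exact: loop_fst.
- by move=> x t /=; rewrite pF pG pC.
- by move=> p; rewrite !det_mulmx !mulr_gt0 ?det_inv_gt0.
- by move=> x /=; rewrite F0 G0 mulmxKV// unitmx_det_gt0.
- by move=> x /=; rewrite F1 G1 mulmxV ?mul1mx// unitmx_det_gt0.
Qed.

Lemma homotopic_mul m (B C B' C' : R -> 'M[R]_m) :
  homotopic B C -> homotopic B' C' ->
  homotopic (fun x => B x *m B' x) (fun x => C x *m C' x).
Proof.
move=> [F [cF pF dF F0 F1]] [G [cG pG dG G0 G1]].
exists (fun p => F p *m G p); split.
- exact: mxcont_mul.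
- by move=> x t; rewrite pF pG.
- by move=> p; rewrite det_mulmx mulr_gt0.
- by move=> x; rewrite F0 G0.
- by move=> x; rewrite F1 G1.
Qed.

Lemma homotopic_block m n (B C : R -> 'M[R]_m) (B' C' : R -> 'M[R]_n) :
  homotopic B C -> homotopic B' C' ->
  homotopic (fun x => block_mx (B x) 0 0 (B' x))
            (fun x => block_mx (C x) 0 0 (C' x)).
Proof.
move=> [F [cF pF dF F0 F1]] [G [cG pG dG G0 G1]].
exists (fun p => block_mx (F p) 0 0 (G p)); split.
- by apply: mxcont_block => //; exact: mxcont_cst.
- by move=> x t; rewrite pF pG.
- by move=> p; rewrite det_ublock mulr_gt0.
- by move=> x; rewrite F0 G0.
- by move=> x; rewrite F1 G1.
Qed.

Lemma homotopic_double m (B C : R -> 'M[R]_m) :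
  homotopic B C -> homotopic (fun x => B (2 * x)) (fun x => C (2 * x)).
Proof.
move=> [F [cF pF dF F0 F1]]; exists (fun p => F (2 * p.1, p.2)); split=> //.
- apply: mxcont_comp cF; apply: continuous_pairf; last exact: continuous_snd.
  apply: continuous_mul; first exact: continuous_cst.
  exact: continuous_fst.
- by move=> x t /=; rewrite mulrDr mulr1 (natrD _ 1 1) addrA !pF.
Qed.

Lemma loop_cst m (M : 'M[R]_m) : 0 < \det M -> loop (fun=> M).
Proof. by move=> M0; split=> //; exact: mxcont_cst. Qed.

Lemma homotopic_line m (B C : R -> 'M[R]_m) :
  loop B -> loop C ->
  (forall x t, 0 <= t <= 1 -> 0 < \det ((1 - t) *: B x + t *: C x)) ->
  homotopic B C.
Proof.
move=> lB lC dF.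
apply: (@homotopicP _ _ _ (fun p => (1 - p.2) *: B p.1 + p.2 *: C p.1)).
- apply: mxcont_add; apply: mxcont_scale; [| exact: loop_fst| |exact: loop_fst].
    apply: continuous_add; first exact: continuous_cst.
    by apply: continuous_opp; exact: continuous_snd.
  exact: continuous_snd.
- by move=> x t /=; case: lB => _ -> _; case: lC => _ -> _.
- by move=> x t t01 /=; exact: dF.
- by move=> x /=; rewrite subr0 scale1r scale0r addr0.
- by move=> x /=; rewrite subrr scale1r scale0r add0r.
Qed.

(** The determinant ignores the off-diagonal block, which can therefore be scaled linearly to
    zero. *)
Lemma homotopic_ublock m n (B : R -> 'M[R]_m) (N : R -> 'M[R]_(m, n))
    (D : R -> 'M[R]_n) :
  loop (fun x => block_mx (B x) (N x) 0 (D x)) -> loop B -> loop D ->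
  homotopic (fun x => block_mx (B x) (N x) 0 (D x))
            (fun x => block_mx (B x) 0 0 (D x)).
Proof.
move=> lT lB lD; apply: homotopic_line => // [|x t t01].
  by have := homotopic_block (homotopic_refl lB) (homotopic_refl lD);
     exact: homotopic_loopl.
rewrite !scale_block_mx add_block_mx !scaler0 !addr0 -!scalerDl !subrK !scale1r.
by rewrite det_ublock mulr_gt0//; [case: lB|case: lD].
Qed.

Lemma homotopic_lblock m n (B : R -> 'M[R]_m) (N : R -> 'M[R]_(n, m))
    (D : R -> 'M[R]_n) :
  loop (fun x => block_mx (B x) 0 (N x) (D x)) -> loop B -> loop D ->
  homotopic (fun x => block_mx (B x) 0 (N x) (D x))
            (fun x => block_mx (B x) 0 0 (D x)).
Proof.
move=> lT lB lD; apply: homotopic_line => // [|x t t01].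
  by have := homotopic_block (homotopic_refl lB) (homotopic_refl lD);
     exact: homotopic_loopl.
rewrite !scale_block_mx add_block_mx !scaler0 !addr0 -!scalerDl !subrK !scale1r.
by rewrite det_lblock mulr_gt0//; [case: lB|case: lD].
Qed.

End homotopy.

(** * Distance to the nearest integer *)

Section distance_to_integers.
Context {R : realType}.
Implicit Types x y : R.

Definition nint x : int := Num.floor (x + 2^-1).
Definition dint x : R := `|x - (nint x)%:~R|.

Lemma dint_le_half x : dint x <= 2^-1.
Proof.
rewrite /dint /nint ler_norml.
have := floor_le (x + 2^-1); have := floorD1_gt (x + 2^-1).
by rewrite intrD; set k := (Num.floor _)%:~R; lra.
Qed.

(** Another integer is at distance at least 1 from [nint x], while [x] is within one half of it. *)
Lemma dint_min x (k : int) : dint x <= `|x - k%:~R|.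
Proof.
have [->//|nk] := eqVneq k (nint x).
have k1 : 1 <= `|(k - nint x)%:~R : R|.
  by rewrite -intr_norm (ler_int _ 1) -gtz0_ge1 normr_gt0 subr_eq0.
have := dint_le_half x; move: k1; rewrite /dint intrD rmorphN/=.
set a := k%:~R; set b := (nint x)%:~R => h1 h2.
have : `|a - b| <= `|x - a| + `|x - b|.
  by rewrite (distrC x a) (le_trans _ (ler_normD _ _))// subrKA.
by lra.
Qed.

Lemma dint_lip x y : dint x - dint y <= `|x - y|.
Proof.
rewrite lerBlDr (le_trans (dint_min x (nint y)))// /dint.
by rewrite (le_trans _ (ler_normD _ _))// subrKA.
Qed.

Lemma dint_continuous : continuous dint.
Proof.
move=> x; apply/cvgrPdist_lt => e e0; near=> y.
apply: (@le_lt_trans _ _ `|x - y|).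
  by rewrite ler_norml lerNl opprB distrC dint_lip distrC dint_lip.
by near: y; move/cvgrPdist_lt: (@cvg_id _ (nbhs x)); apply.
Unshelve. all: by end_near. Qed.

Lemma dintDz x (k : int) : dint (x + k%:~R) = dint x.
Proof.
rewrite /dint /nint [x + _ + 2^-1]addrAC floorDrz ?intr_int// intrKfloor intrD.
by rewrite opprD addrACA subrr addr0.
Qed.

Lemma dintD1 x : dint (x + 1) = dint x.
Proof. exact: (dintDz x 1). Qed.

End distance_to_integers.

(** * Similarities of the plane *)

Section planar.
Context {R : realType}.

(** Multiplication by the complex number a + i c. *)
Definition rho (a c : R) : 'M[R]_2 :=
  \matrix_(i, j) if i == j then a else if i == 0 then - c else c.

Lemma mulmx_rho a c a' c' :
  rho a c *m rho a' c' = rho (a * a' - c * c') (a * c' + c * a').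
Proof.
apply/matrixP => i j; rewrite !mxE !big_ord_recl big_ord0 !mxE.
by case: i => [[|[|//]] ?]; case: j => [[|[|//]] ?] /=; ring.
Qed.

Lemma det_rho a c : \det (rho a c) = a ^+ 2 + c ^+ 2.
Proof.
rewrite (expand_det_row _ 0) !big_ord_recl big_ord0 /cofactor !det_mx11 !mxE/=.
by rewrite expr0; ring.
Qed.

Lemma rho10 : rho 1 0 = 1%:M.
Proof.
apply/matrixP => i j; rewrite !mxE oppr0.
by case: eqP => // _; case: ifP.
Qed.

Lemma mxcont_rho (T : topologicalType) (a c : T -> R) :
  continuous a -> continuous c -> mxcont (fun x => rho (a x) (c x)).
Proof.
move=> ca cc i j; under eq_fun do rewrite mxE.
case: (i == j) => //; case: (i == 0) => //.
exact: continuous_opp.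
Qed.

Lemma sqr_sum_gt0 (a c : R) : (a, c) != (0, 0) -> 0 < a ^+ 2 + c ^+ 2.
Proof.
rewrite lt_def addr_ge0 ?sqr_ge0// andbT paddr_eq0 ?sqr_ge0// !sqrf_eq0.
by rewrite xpair_eqE.
Qed.

(** Two complex numbers at an acute angle: the cross term in the squared modulus of a convex
    combination is nonnegative, so the segment misses 0. *)
Lemma homotopic_rho (a c a' c' : R -> R) :
  loop (fun x => rho (a x) (c x)) -> loop (fun x => rho (a' x) (c' x)) ->
  (forall x, 0 < a x * a' x + c x * c' x) ->
  homotopic (fun x => rho (a x) (c x)) (fun x => rho (a' x) (c' x)).
Proof.
move=> l1 l2 h; apply: homotopic_line => // x t /andP[t0 t1].
have [_ _ /(_ x)] := l1; have [_ _ /(_ x)] := l2; rewrite !det_rho => d2 d1.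
have -> : (1 - t) *: rho (a x) (c x) + t *: rho (a' x) (c' x) =
    rho ((1 - t) * a x + t * a' x) ((1 - t) * c x + t * c' x).
  apply/matrixP => i j; rewrite !mxE.
  by case: eqP => //; case: eqP => // _ _; ring.
rewrite det_rho.
have -> : ((1 - t) * a x + t * a' x) ^+ 2 + ((1 - t) * c x + t * c' x) ^+ 2 =
  (1 - t) ^+ 2 * (a x ^+ 2 + c x ^+ 2) + t ^+ 2 * (a' x ^+ 2 + c' x ^+ 2)
  + 2 * t * (1 - t) * (a x * a' x + c x * c' x) by ring.
move: d1 d2 (h x); set u := a x * _ + _.
set v := a x ^+ 2 + _; set w := a' x ^+ 2 + _.
move=> d1 d2 u0.
have [->|t_neq0] := eqVneq t 0; first by rewrite subr0 expr1n expr0n/=; lra.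
have tp : 0 < t by rewrite lt_def t_neq0.
have p1 : 0 <= (1 - t) ^+ 2 * v by rewrite mulr_ge0// ?sqr_ge0// ltW.
have p2 : 0 < t ^+ 2 * w by rewrite mulr_gt0// exprn_gt0.
have p3 : 0 <= 2 * t * (1 - t) * u.
  by rewrite !mulr_ge0// ?subr_ge0// ltW.
by lra.
Qed.

(* Segments from [1] miss [0] for [0 < a]; otherwise go through [i], or write *)
(* [rho a c] as [i * i * rho (- a) (- c)].                                    *)
Lemma homotopic_rho_cst (a c : R) :
  (a, c) != (0, 0) -> homotopic (fun=> rho a c) (fun=> 1%:M).
Proof.
move=> /sqr_sum_gt0 n0.
have lr (b d : R) : 0 < b ^+ 2 + d ^+ 2 -> loop (fun=> rho b d).
  by move=> h; apply: loop_cst; rewrite det_rho.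
have l1 : loop (fun=> rho 1 0 : 'M[R]_2) by apply: lr; rewrite !expr2; lra.
have li : loop (fun=> rho 0 1 : 'M[R]_2) by apply: lr; rewrite !expr2; lra.
have i1 : homotopic (fun=> rho 0 1 : 'M[R]_2) (fun=> 1%:M).
  apply: (@homotopic_trans _ _ (fun=> rho 1 1)); rewrite -?rho10.
    apply: (@homotopic_rho (fun=> 0) (fun=> 1)) => [//||x];
      last by rewrite /=; lra.
    by apply: lr; rewrite !expr2; lra.
  apply: (@homotopic_rho (fun=> 1) (fun=> 1)) => [|//|x];
    last by rewrite /=; lra.
  by apply: lr; rewrite !expr2; lra.
have aux (b d : R) : 0 < b ^+ 2 + d ^+ 2 -> 0 < b \/ 0 < d ->
    homotopic (fun=> rho b d) (fun=> 1%:M).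
  move=> h [b0|d0].
    rewrite -rho10; apply: (@homotopic_rho (fun=> b) (fun=> d)) => [|//|x].
      exact: lr.
    by rewrite /=; lra.
  apply: homotopic_trans i1.
  by apply: (@homotopic_rho (fun=> b) (fun=> d)) => [|//|x];
    [exact: lr|rewrite /=; lra].
have [a0|a0] := ltP 0 a; first by apply: aux => //; left.
have [c0|c0] := ltP 0 c; first by apply: aux => //; right.
have H : homotopic (fun=> rho (- a) (- c)) (fun=> 1%:M).
  apply: aux; first by rewrite !sqrrN.
  have [a1|a1] := ltP a 0; [by left; lra|right].
  move: n0; rewrite (_ : a = 0); last by lra.
  by rewrite expr0n/= add0r exprn_even_gt0//= => cn0; lra.
have E : rho 0 1 *m rho 0 1 *m rho (- a) (- c) = rho a c.
  by rewrite !mulmx_rho; congr rho; ring.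
by have := homotopic_mul (homotopic_mul i1 i1) H; rewrite E !mulmx1.
Qed.

End planar.

(** * Contracting doubled loops of similarities *)

Section doubling.
Context {R : realType}.

Lemma loop_rho (a c : R -> R) :
  continuous a -> continuous c -> (forall x, a (x + 1) = a x) ->
  (forall x, c (x + 1) = c x) -> (forall x, 0 < a x ^+ 2 + c x ^+ 2) ->
  loop (fun x => rho (a x) (c x)).
Proof.
move=> ca cc pa pc h; split; first exact: mxcont_rho.
  by move=> x; rewrite pa pc.
by move=> x; rewrite det_rho.
Qed.

Lemma loop_rhoE (a c : R -> R) : loop (fun x => rho (a x) (c x)) ->
  [/\ continuous a, continuous c, forall x, a (x + 1) = a x,
      forall x, c (x + 1) = c x & forall x, 0 < a x ^+ 2 + c x ^+ 2].
Proof.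
move=> [cM pM dM]; split.
- have := cM 0 0; rewrite (_ : (fun _ => _) = a) //.
  by apply/funext => x; rewrite mxE.
- have := cM 1 0; rewrite (_ : (fun _ => _) = c) //.
  by apply/funext => x; rewrite mxE.
- by move=> x; have /matrixP/(_ 0 0) := pM x; rewrite !mxE.
- by move=> x; have /matrixP/(_ 1 0) := pM x; rewrite !mxE.
- by move=> x; have := dM x; rewrite det_rho.
Qed.

(* [z (x + t dint x) * z (x - t dint x)] joins [z (x) ^ 2] to                 *)
(* [z (2 x) * z 0]: at time 1 one of the two arguments is an integer.         *)
Lemma homotopic_rho_double (a c : R -> R) :
  loop (fun x => rho (a x) (c x)) ->
  homotopic (fun x => rho (a x) (c x) *m rho (a x) (c x))
            (fun x => rho (a (2 * x)) (c (2 * x)) *m rho (a 0) (c 0)).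
Proof.
move=> /[dup] /loop_rhoE [ca cc pa pc h] lr.
pose F (s : R) (p : R * R) := rho (a (p.1 + s * (p.2 * dint p.1)))
                                (c (p.1 + s * (p.2 * dint p.1))).
have cF s : mxcont (F s).
  have cs : continuous (fun p : R * R => p.1 + s * (p.2 * dint p.1)).
    apply: continuous_add; first exact: continuous_fst.
    apply: continuous_mul; first exact: continuous_cst.
    apply: continuous_mul; first exact: continuous_snd.
    move=> p; apply: (@continuous_comp _ _ _ fst dint);
      last exact: dint_continuous.
    exact: continuous_fst.
  apply: mxcont_rho => p.
    exact: (@continuous_comp _ _ _ (fun p : R * R => _) a p (cs p) (ca _)).
  exact: (@continuous_comp _ _ _ (fun p : R * R => _) c p (cs p) (cc _)).
exists (fun p => F 1 p *m F (-1) p); split.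
- exact: mxcont_mul.
- by move=> x t; rewrite /F /= dintD1 !(addrAC x 1) !pa !pc.
- by move=> p; rewrite det_mulmx !det_rho mulr_gt0.
- by move=> x; rewrite /F /= !mul0r !mulr0 !addr0.
move=> x; rewrite /F /= !mul1r mulN1r /dint; set k := nint x.
wlog kx : / k%:~R <= x.
  move=> H; have [/H//|/ltW xk] := leP k%:~R x.
  rewrite ler0_norm ?subr_le0// opprB.
  rewrite (_ : x + _ = 0 + k%:~R); last by ring.
  rewrite (_ : x - _ = 2 * x + (- k)%:~R); last by rewrite rmorphN/=; ring.
  by rewrite !(periodicz pa) !(periodicz pc) !mulmx_rho; congr rho; ring.
rewrite ger0_norm ?subr_ge0//.
rewrite (_ : x + _ = 2 * x + (- k)%:~R); last by rewrite rmorphN/=; ring.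
rewrite (_ : x - _ = 0 + k%:~R); last by ring.
by rewrite !(periodicz pa) !(periodicz pc).
Qed.

Lemma block_rho_conj (a c : R) (s : 'I_(1 + 2) -> R) (i j : 'I_(1 + 2)) :
  (forall k : 'I_(1 + 2), s k = if (k < 2)%N then -1 else 1) ->
  s i * block_mx 1%:M 0 0 (rho a c) i j * s j =
  block_mx 1%:M 0 0 (rho a (- c)) i j.
Proof.
move=> sE; rewrite !sE.
case: (split_ordP i) => i' ->; case: (split_ordP j) => j' ->.
- by rewrite !block_mxEul !ord1 !mxE /=; ring.
- by rewrite !block_mxEur !mxE /=; ring.
- by rewrite !block_mxEdl !mxE /=; ring.
- rewrite !block_mxEdr !mxE /=.
  by case: i' => [[|[|//]] ?]; case: j' => [[|[|//]] ?] /=; ring.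
Qed.

(* Conjugation by [diag (-1, -1, 1)], which is joined to [1], inverts the     *)
(* rotations of the last two coordinates.                                     *)
Lemma homotopic_rho_conj (a c : R -> R) :
  loop (fun x => rho (a x) (c x)) ->
  homotopic (fun x => block_mx 1%:M 0 0 (rho (a x) (c x)) : 'M[R]_(1 + 2))
            (fun x => block_mx 1%:M 0 0 (rho (a x) (- c x))).
Proof.
move=> lr.
(* The splitting is [2 + 1] here but [1 + 2] for the loop: the half-turn in the first two
   coordinates meets the plane of [rho] in one axis, and so acts there as a reflection. *)
pose s : 'rV[R]_(2 + 1) := row_mx (const_mx (-1) : 'rV_2) (const_mx 1 : 'rV_1).
have S1 : homotopic (fun=> diag_mx s) (fun=> 1%:M).
  have h := @homotopic_rho_cst R (-1) 0.
  have {}h : homotopic (fun=> rho (-1 : R) 0) (fun=> 1%:M).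
    by apply: h; rewrite xpair_eqE oppr_eq0 oner_eq0.
  have sE : block_mx (rho (-1) 0) 0 0 1%:M = diag_mx s :> 'M[R]_(2 + 1).
    rewrite /s diag_mx_row; congr block_mx.
      by apply/matrixP => i j; rewrite !mxE oppr0;
        case: (i == j); case: (i == 0).
    by apply/matrixP => i j; rewrite !mxE !ord1.
  have d1 : 0 < \det (1%:M : 'M[R]_1) by rewrite det1.
  have := homotopic_block h (homotopic_refl (loop_cst d1)).
  by rewrite -scalar_mx_block sE.
have l1 : loop (fun _ : R => 1%:M : 'M[R]_1) by apply: loop_cst; rewrite det1.
have hr := homotopic_block (homotopic_refl l1) (homotopic_refl lr).
have := homotopic_mul (homotopic_mul S1 hr) S1.
under eq_fun do rewrite mul_diag_mx mul_mx_diag.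
(* The product homotopy starts at the conjugated loop and ends at the original one. *)
move=> H; apply: homotopic_sym; move: H.
under [X in homotopic _ X]eq_fun do rewrite mul1mx mulmx1.
congr homotopic; apply/funext => x; apply/matrixP => i j.
have sE (k : 'I_(2 + 1)) : s 0 k = if (k < 2)%N then -1 else 1.
  case: (split_ordP k) => l ->.
    by rewrite /s row_mxEl mxE.
  by rewrite /s (@row_mxEr _ _ 2 1) mxE.
by rewrite mxE mxE; exact: (@block_rho_conj _ _ (fun k => s 0 k)).
Qed.

(* [R ^ 2 ~ R * conj R = |R| ^ 2 ~ 1]; this is where [3 <= d] is used. *)
Lemma homotopic_rho_sqr (a c : R -> R) :
  loop (fun x => rho (a x) (c x)) ->
  homotopic (fun x => block_mx 1%:M 0 0 (rho (a x) (c x) *m rho (a x) (c x))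
                      : 'M[R]_(1 + 2)) (fun=> 1%:M).
Proof.
move=> lr; have [ca cc pa pc h] := loop_rhoE lr.
have l1 m : loop (fun _ : R => 1%:M : 'M[R]_m) by apply: loop_cst; rewrite det1.
have hr := homotopic_block (homotopic_refl (l1 1)) (homotopic_refl lr).
have := homotopic_mul hr (homotopic_rho_conj lr).
under eq_fun do rewrite mulmx_block !mulmx0 !mul0mx !addr0 !add0r mulmx1.
under [X in homotopic _ X -> _]eq_fun do
  rewrite mulmx_block !mulmx0 !mul0mx !addr0 !add0r mulmx1.
move=> H; apply: homotopic_trans H _.
rewrite [X in homotopic _ X](_ : _ = fun=> block_mx 1%:M 0 0 1%:M); last first.
  by apply/funext => x; rewrite -scalar_mx_block.
apply: homotopic_block; first exact: homotopic_refl.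
have E x : rho (a x) (c x) *m rho (a x) (- c x) = rho (a x ^+ 2 + c x ^+ 2) 0.
  by rewrite mulmx_rho; congr rho; ring.
under eq_fun do rewrite E; rewrite -rho10.
apply: (@homotopic_rho _ _ _ (fun=> 1) (fun=> 0)).
- apply: loop_rho => [|||//|x]; last by rewrite expr0n addr0 exprn_gt0.
  + by apply: continuous_add; apply: continuous_mul.
  + exact: continuous_cst.
  + by move=> x; rewrite pa pc.
- by rewrite rho10; exact: l1.
- by move=> x; rewrite mulr1 mulr0 addr0.
Qed.

(** As complex loops, z(2x) ~ z(2x) z(0) ~ z(x)^2, since the constant z(0) can be contracted; the
    square is then contracted with the help of the third dimension. *)
Lemma homotopic_rho_double1 (a c : R -> R) :
  loop (fun x => rho (a x) (c x)) ->
  homotopic (fun x => block_mx 1%:M 0 0 (rho (a (2 * x)) (c (2 * x)))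
                      : 'M[R]_(1 + 2)) (fun=> 1%:M).
Proof.
move=> lr; have [_ _ _ _ h] := loop_rhoE lr.
have l1 : loop (fun _ : R => 1%:M : 'M[R]_1) by apply: loop_cst; rewrite det1.
have z0 : (a 0, c 0) != (0, 0).
  by apply/eqP => -[a0 c0]; have := h 0; rewrite a0 c0 expr0n addr0 ltxx.
have h2 := homotopic_double (homotopic_refl lr).
have := homotopic_mul h2 (homotopic_sym (homotopic_rho_cst z0)).
under eq_fun do rewrite mulmx1.
move=> /homotopic_trans /(_ (homotopic_sym (homotopic_rho_double lr))).
move=> /(homotopic_block (homotopic_refl l1)) /homotopic_trans; apply.
exact: homotopic_rho_sqr.
Qed.

(** Keep the first column and move the second one to its quarter-turn; the determinant is affine
    along this segment and positive at both ends. *)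
Lemma homotopic_rho2 (A : R -> 'M[R]_2) : loop A ->
  let B x := rho (A x 0 0) (A x 1 0) in loop B /\ homotopic A B.
Proof.
move=> lA B; have [cA pA dA] := lA.
have dE x : \det (A x) = A x 0 0 * A x 1 1 - A x 0 1 * A x 1 0.
  rewrite (expand_det_row _ 0) !big_ord_recl big_ord0 /cofactor !det_mx11 !mxE.
  have -> : lift 0 0 = 1 :> 'I_2 by apply: val_inj.
  have -> : lift 1 0 = 0 :> 'I_2 by apply: val_inj.
  by rewrite /= expr0 expr1; ring.
have lB : loop B.
  apply: loop_rho; [exact: cA|exact: cA| | |].
  - by move=> x; rewrite pA.
  - by move=> x; rewrite pA.
  move=> x; apply: sqr_sum_gt0; apply/eqP => -[a0 c0].
  by have := dA x; rewrite dE a0 c0 mul0r mulr0 subrr ltxx.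
split=> //; apply: homotopic_line => // x t /andP[t0 t1].
have -> : \det ((1 - t) *: A x + t *: B x) =
    (1 - t) * \det (A x) + t * \det (B x).
  rewrite dE det_rho !(expand_det_row _ 0) !big_ord_recl !big_ord0 /cofactor.
  rewrite !det_mx11 !mxE.
  have -> : lift 0 0 = 1 :> 'I_2 by apply: val_inj.
  have -> : lift 1 0 = 0 :> 'I_2 by apply: val_inj.
  by rewrite /= expr0 expr1; ring.
have := dA x; have [_ _ /(_ x)] := lB.
set u := \det _; set v := \det _ => u0 v0.
by have [->|] := eqVneq t 0; nra.
Qed.

End doubling.

(** * Reduction to the plane *)

Section perturbation.
Context {R : realType}.

(** The tube lemma around the slice at 0. *)
Lemma compact_pos_near (T : topologicalType) (K : set T) (f : T * R -> R) :
  compact K -> continuous f -> (forall x, K x -> 0 < f (x, 0)) ->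
  exists2 e : R, 0 < e & forall x h, K x -> `|h| < e -> 0 < f (x, h).
Proof.
move=> /compact_near_coveringP cK cf f0.
have := cK R (nbhs (0 : R)) (fun h x => 0 < f (x, h)) _.
case=> [x Kx|e /= e0 he].
  have : nbhs (f (x, 0)) [set z | 0 < z] by exact/lt_nbhsr/f0.
  move=> /(cf (x, 0)) nf.
  by apply: (@filterS _ (nbhs (x, 0 : R)) _ _ _ _ nf) => -[].
by exists e => // x h Kx he'; apply: he => //=; rewrite /ball_ sub0r normrN.
Qed.

Lemma periodic_pos_near (f : R * R -> R) :
  continuous f -> (forall x h, f (x + 1, h) = f (x, h)) ->
  (forall x, 0 < f (x, 0)) ->
  exists2 e : R, 0 < e & forall x h, `|h| < e -> 0 < f (x, h).
Proof.
move=> cf pf f0.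
have [|e e0 he] := compact_pos_near (@segment_compact R 0 1) cf.
  by move=> x _; exact: f0.
exists e => // x h hh.
have <- : f (x - (Num.floor x)%:~R, h) = f (x, h).
  by rewrite -rmorphN/= (periodicz (f := fun x => f (x, h))).
apply: he => //=; rewrite in_itv/= subr_ge0 floor_le/= lerBlDl -intrD1 ltW//.
by rewrite floorD1_gt.
Qed.

(** The periodic tent of height 1 and half-width 1/N centred at i/N. *)
Definition hat (N i : nat) (x : R) : R :=
  Order.max 0 (1 - N%:R * dint (x - i%:R / N%:R)).

Lemma hat_continuous N i : continuous (hat N i).
Proof.
have cd : continuous (fun x : R => 1 - N%:R * dint (x - i%:R / N%:R)).
  apply: continuous_add; first exact: continuous_cst.
  apply: continuous_opp; apply: continuous_mul; first exact: continuous_cst.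
  move=> x; apply: (@continuous_comp _ _ _ (fun x : R => x - i%:R / N%:R) dint).
    apply: continuous_add; first exact: continuous_id.
    exact: continuous_cst.
  exact: dint_continuous.
by move=> x; exact: (continuous_max (cvg_cst _) (cd x)).
Qed.

Lemma hatD1 N i x : hat N i (x + 1) = hat N i x.
Proof. by rewrite /hat addrAC dintD1. Qed.

Lemma hat_ge0 N i x : 0 <= hat N i x.
Proof. by rewrite le_max lexx. Qed.

Lemma hat_gt0 N i x : (0 < N)%N ->
  0 < hat N i x <-> exists k : int, `|x - i%:R / N%:R - k%:~R| < N%:R^-1.
Proof.
move=> N0; have N0' : 0 < N%:R :> R by rewrite ltr0n.
rewrite /hat lt_max ltxx/= subr_gt0 -ltr_pdivlMl// mulr1.
split=> [h|[k hk]]; first by exists (nint (x - i%:R / N%:R)).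
exact: le_lt_trans (dint_min _ k) hk.
Qed.

(** With f the floor of N x, only the centres f/N and (f + 1)/N can be closer to x than 1/N; their
    indices are taken modulo N. *)
Lemma hat_support N x : (0 < N)%N -> exists i j : 'I_N,
  0 < hat N i x /\ forall k : 'I_N, hat N k x != 0 -> k = i \/ k = j.
Proof.
move=> N0; have N0' : 0 < N%:R :> R by rewrite ltr0n.
have NZ : (N%:Z != 0)%R by rewrite eqz_nat -lt0n.
pose r (z : int) : 'I_N := Ordinal (ltn_pmod `|(z %% N)%Z|%N N0).
have rE (z : int) : exists k, z = (r z : nat)%:Z + k * N%:Z.
  exists (z %/ N)%Z; rewrite {1}(divz_eq z N) addrC /=; congr +%R.
  have z0 := modz_ge0 z NZ; have zN := ltz_pmod z (N0 : 0 < N%:Z).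
  by rewrite modn_small ?gez0_abs// -ltz_nat gez0_abs.
have rI (z : int) (i : 'I_N) k : z = (i : nat)%:Z + k * N%:Z -> i = r z.
  move=> ->; apply: val_inj => /=; rewrite addrC modzMDl modz_nat absz_nat.
  by rewrite modn_mod modn_small.
pose f := Num.floor (N%:R * x).
have fle := floor_le (N%:R * x); have flt := floorD1_gt (N%:R * x).
rewrite -/f intrD in fle flt.
have scal (i : nat) (k : int) : `|x - i%:R / N%:R - k%:~R| < N%:R^-1 <->
    `|N%:R * x - (i%:Z + k * N%:Z)%:~R| < 1.
  rewrite intrD intrM /= -!pmulrn -[X in _ < X <-> _](mul1r) ltr_pdivlMr//.
  rewrite -[X in _ * X < _](gtr0_norm N0') -normrM.
  suff -> : (x - i%:R / N%:R - k%:~R) * N%:R =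
    N%:R * x - (i%:R + k%:~R * N%:R) by [].
  by field; rewrite gt_eqF.
exists (r f), (r (f + 1)); split.
  apply/hat_gt0 => //; have [k fk] := rE f; exists k; apply/scal.
  by rewrite -fk ltr_norml; lra.
move=> i hi; have /hat_gt0 : 0 < hat N i x by rewrite lt_def hi hat_ge0.
case=> // k /scal; set z := (_ + _ : int) => hz.
suff : z = f \/ z = f + 1 by case=> <-; [left|right]; exact: rI.
move: hz; rewrite ltr_norml => /andP[h1 h2].
have : (z < f + 2)%R by rewrite -(ltr_int R) intrD; lra.
have : (f - 1 < z)%R by rewrite -(ltr_int R) intrB; lra.
clear; lia.
Qed.

End perturbation.

(** * General position and splitting off one dimension *)

Section reduction.
Context {R : realType}.

Definition moment d (s : R) : 'cV[R]_d := \col_k s ^+ k.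

(** The matrix with columns [p] and [q] has rank at most 2 < d, hence a nonzero left kernel. *)
Lemma annihilator d (p q : 'cV[R]_d) : (3 <= d)%N ->
  exists L : 'rV[R]_d, [/\ L != 0, L *m p = 0 & L *m q = 0].
Proof.
move=> d3; pose M : 'M[R]_(d, 1 + 1) := row_mx p q.
have kM : kermx M != 0.
  rewrite -mxrank_eq0 mxrank_ker subn_eq0 -ltnNge.
  exact: leq_ltn_trans (rank_leq_col M) _.
exists (nz_row (kermx M)); rewrite nz_row_eq0 kM.
have /sub_kermxP : (nz_row (kermx M) <= kermx M)%MS by exact: nz_row_sub.
by rewrite mul_mx_row -[0]row_mx0 => /eq_row_mx[-> ->].
Qed.

Lemma horner_rVpoly d (L : 'rV[R]_d) (s : R) :
  (rVpoly L).[s] = (L *m moment d s) 0 0.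
Proof.
rewrite (horner_coef_wide _ (size_poly _ _)) mxE.
by apply: eq_bigr => i _; rewrite coef_rVpoly_ord mxE.
Qed.

Lemma poly_neq0_nonroot (p : {poly R}) : p != 0 -> exists s, p.[s] != 0.
Proof.
move=> p0; apply: contrapT => /forallNP h.
pose rs := [seq n%:R | n <- iota 0 (size p)] : seq R.
have : (size rs < size p)%N.
  apply: max_poly_roots => //.
    by apply/allP => x _; apply/rootP/eqP; move: (h x) => /negP; rewrite negbK.
  by rewrite map_inj_uniq ?iota_uniq// => i j /eqP; rewrite eqr_nat => /eqP.
by rewrite size_map size_iota ltnn.
Qed.

(** A functional evaluated on the moment curve is a polynomial in the parameter with the same
    coefficients. The product over all pairs of the annihilating polynomials is nonzero, so some [s]
    is a root of none. *)
Lemma avoid_planes d N (p : 'I_N -> 'cV[R]_d) : (3 <= d)%N ->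
  exists s : R, forall i j, exists L : 'rV[R]_d,
    [/\ L *m p i = 0, L *m p j = 0 & L *m moment d s != 0].
Proof.
move=> d3; have /choice[L HL] : forall ij : 'I_N * 'I_N, exists L : 'rV[R]_d,
    [/\ L != 0, L *m p ij.1 = 0 & L *m p ij.2 = 0].
  by move=> ij; exact: annihilator.
have [|s hs] := @poly_neq0_nonroot (\prod_ij rVpoly (L ij)).
  apply/prodf_neq0 => ij _; have [+ _ _] := HL ij; apply: contraNneq => L0.
  by rewrite -[L ij]rVpolyK L0 linear0.
exists s => i j; exists (L (i, j)); have [_ h1 h2] := HL (i, j); split=> //.
move: hs; rewrite horner_prod => /prodf_neq0 /(_ (i, j) isT).
by rewrite horner_rVpoly; apply: contraNneq => ->; rewrite mxE.
Qed.

(* A piecewise linear loop lies in finitely many planes, which in dimension   *)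
(* at least 3 all miss some point of the moment curve.                        *)
Lemma perturb d (v : R -> 'cV[R]_d) (c : R -> 'rV[R]_d) : (3 <= d)%N ->
  mxcont v -> (forall x, v (x + 1) = v x) ->
  mxcont c -> (forall x, c (x + 1) = c x) ->
  (forall x, 0 < (c x *m v x) 0 0) ->
  exists (w : R -> 'cV[R]_d) (s : R),
    [/\ mxcont w, forall x, w (x + 1) = w x,
        forall x, 0 < (c x *m w x) 0 0
      & forall x a, w x != a *: moment d s].
Proof.
move=> d3 cv pv cc pc cv0.
(* Uniform positivity of this pairing for small shifts fixes the mesh 1/N: every sample that
   contributes to [w x] still pairs positively with [c x]. *)
pose f (p : R * R) := (c p.1 *m v (p.1 + p.2)) 0 0.
have [||x|e e0 he] := @periodic_pos_near _ f.
- apply: mxcont_mul; first by apply: mxcont_comp cc; exact: continuous_fst.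
  apply: mxcont_comp cv; apply: continuous_add; first exact: continuous_fst.
  exact: continuous_snd.
- by move=> x h; rewrite /f /= pc addrAC pv.
- by rewrite /f /= addr0.
pose N := (Num.truncn e^-1).+1.
have N0 : 0 < N%:R :> R by rewrite ltr0n.
have Ne : N%:R^-1 < e.
  by rewrite invf_plt ?posrE//; apply: truncnS_gt.
pose p (i : 'I_N) := v (i%:R / N%:R).
have [s hs] := avoid_planes p d3.
pose w x := \sum_(i < N) hat N i x *: p i.
have cwE x : (c x *m w x) 0 0 = \sum_(i < N) hat N i x * (c x *m p i) 0 0.
  rewrite /w mulmx_sumr summxE; apply: eq_bigr => i _.
  by rewrite -scalemxAr mxE.
have cp0 x (i : 'I_N) : 0 < hat N i x -> 0 < (c x *m p i) 0 0.
  move=> /hat_gt0 -/(_ isT)[k hk].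
  have := he x (i%:R / N%:R + k%:~R - x); rewrite /f /= distrC opprD addrA.
  by rewrite (lt_trans hk Ne) (addrC x) subrK (periodicz pv); apply.
have cw0 x : 0 < (c x *m w x) 0 0.
  have [i [_ [hi _]]] := @hat_support R N x isT.
  rewrite cwE (bigD1 i)//= ltr_wpDr ?mulr_gt0//; last exact: cp0.
  apply: sumr_ge0 => j _; have := hat_ge0 N j x.
  by rewrite le_eqVlt => /predU1P[<-|h]; rewrite ?mul0r// ltW// mulr_gt0// cp0.
exists w, s; split=> //.
- move=> i j; rewrite /w; under eq_fun do rewrite summxE.
  apply: continuous_sum => k _; under eq_fun do rewrite mxE.
  by apply: continuous_mul; [exact: hat_continuous|exact: continuous_cst].
- by move=> x; apply: eq_bigr => i _; rewrite hatD1.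
move=> x a; apply/eqP => wE.
have [i [j [_ hsup]]] := @hat_support R N x isT.
have [L [Li Lj Ls]] := hs i j.
(* [w x] combines two samples, both killed by [L], while the moment vector is not; so [a = 0], and
   [w x = 0] contradicts the positive pairing. *)
have : L *m w x = 0.
  rewrite /w mulmx_sumr big1// => k _; rewrite -scalemxAr.
  have [->|hk] := eqVneq (hat N k x) 0; first by rewrite scale0r.
  by have [->|->] := hsup _ hk; rewrite ?Li ?Lj scaler0.
rewrite wE -scalemxAr => /eqP; rewrite scaler_eq0 (negbTE Ls) orbF => /eqP a0.
by have := cw0 x; rewrite wE a0 scale0r mulmx0 mxE ltxx.
Qed.

Definition setcol m (M : 'M[R]_(1 + m)) (w : 'cV[R]_(1 + m)) : 'M[R]_(1 + m) :=
  \matrix_(i, j) if j == 0 then w i 0 else M i j.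

(** Cofactor expansion: with the other columns fixed, invertibility becomes positivity of a linear
    form in the first column, the form [c] to which [perturb] is applied. *)
Lemma det_setcol m (M : 'M[R]_(1 + m)) w :
  \det (setcol M w) = ((\row_i cofactor M i 0) *m w) 0 0.
Proof.
rewrite (expand_det_col _ 0) mxE; apply: eq_bigr => i _.
rewrite !mxE eqxx mulrC; congr (_ * \det _ * _).
by apply/matrixP => k l; rewrite !mxE.
Qed.

Lemma setcol_col m (M : 'M[R]_(1 + m)) : setcol M (col 0 M) = M.
Proof. by apply/matrixP => i j; rewrite !mxE; case: eqP => [->|]. Qed.

Lemma mxcont_sub m1 m2 n1 n2 (F : R -> 'M[R]_(m1 + m2, n1 + n2)) :
  mxcont F -> [/\ mxcont (fun x => ulsubmx (F x)),
    mxcont (fun x => ursubmx (F x)), mxcont (fun x => dlsubmx (F x))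
    & mxcont (fun x => drsubmx (F x))].
Proof.
move=> cF; split=> i j; under eq_fun do rewrite !mxE; exact: cF.
Qed.

Lemma sqr_norm_gt0 m (y : 'cV[R]_m) : y != 0 -> 0 < (y^T *m y) 0 0.
Proof.
move=> y0; have [i yi] : exists i, y i 0 != 0.
  apply: contrapT => /forallNP h; move/eqP: y0; apply; apply/colP => i.
  by rewrite [RHS]mxE; apply/eqP; move: (h i) => /negP; rewrite negbK.
rewrite mxE (bigD1 i)//= mxE -expr2 ltr_wpDr ?exprn_even_gt0//.
by apply: sumr_ge0 => j _; rewrite mxE -expr2 sqr_ge0.
Qed.

(** Once the first column avoids a fixed line, periodic shears carry it to the first basis vector;
    each family of shears contracts to 1, so multiplying by it preserves the homotopy class. *)
Lemma homotopic_reduce m (A : R -> 'M[R]_(1 + m)) : (2 <= m)%N -> loop A ->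
  exists B : R -> 'M[R]_m,
    loop B /\ homotopic A (fun x => block_mx 1%:M 0 0 (B x)).
Proof.
move=> m2 lA; have [cA pA dA] := lA.
pose c x := \row_i cofactor (A x) i 0.
have [|||||x|w [s [cw pw cw0 ws]]] := @perturb (1 + m) (fun x => col 0 (A x)) c.
- by rewrite ltnS.
- by move=> i j; under eq_fun do rewrite mxE; exact: cA.
- by move=> x; rewrite pA.
- by move=> i j; under eq_fun do rewrite mxE; exact: continuous_cofactor.
- by move=> x; rewrite /c pA.
- by rewrite -det_setcol setcol_col.
pose A1 x := setcol (A x) (w x).
have lA1 : loop A1.
  split=> [i j|x|x]; last by rewrite det_setcol; exact: cw0.
    under eq_fun do rewrite mxE.
    by case: (j == 0); [exact: cw|exact: cA].
  by rewrite /A1 pA pw.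
have AA1 : homotopic A A1.
  apply: homotopic_line => // x t /andP[t0 t1].
  have -> : (1 - t) *: A x + t *: A1 x =
      setcol (A x) ((1 - t) *: col 0 (A x) + t *: w x).
    apply/matrixP => i j; rewrite !mxE; case: eqP => [->//|_].
    by rewrite -mulrDl subrK mul1r.
  rewrite det_setcol mulmxDr -!scalemxAr.
  have := cw0 x; have := dA x; rewrite -{1}[A x]setcol_col det_setcol.
  move: (_ *m w x) (_ *m col 0 _) => P Q Q0 P0; rewrite !mxE.
  by have [->|] := eqVneq t 0; nra.
have l1 n : loop (fun _ : R => 1%:M : 'M[R]_n) by apply: loop_cst; rewrite det1.
have unipL (g : R -> 'cV[R]_m) : mxcont g -> (forall x, g (x + 1) = g x) ->
    homotopic (fun=> 1%:M)
      (fun x => block_mx 1%:M 0 (g x) 1%:M : 'M[R]_(1 + m)).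
  move=> cg pg; apply: homotopic_sym.
  rewrite (_ : (fun=> 1%:M) = fun=> block_mx 1%:M 0 0 1%:M); last first.
    by apply/funext => x; rewrite -scalar_mx_block.
  apply: homotopic_lblock => //; split=> [|x|x]; rewrite ?pg//.
    by apply: mxcont_block => //; exact: mxcont_cst.
  by rewrite det_lblock !det1 mulr1.
have unipU (g : R -> 'rV[R]_m) : mxcont g -> (forall x, g (x + 1) = g x) ->
    homotopic (fun=> 1%:M)
      (fun x => block_mx 1%:M (g x) 0 1%:M : 'M[R]_(1 + m)).
  move=> cg pg; apply: homotopic_sym.
  rewrite (_ : (fun=> 1%:M) = fun=> block_mx 1%:M 0 0 1%:M); last first.
    by apply/funext => x; rewrite -scalar_mx_block.
  apply: homotopic_ublock => //; split=> [|x|x]; rewrite ?pg//.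
    by apply: mxcont_block => //; exact: mxcont_cst.
  by rewrite det_ublock !det1 mulr1.
(* The moment vector is (1, u), and the shear by [- u] sends it to the first basis vector. [y] is
   the lower part of the sheared first column, nonzero because that column is no multiple of the
   moment vector. *)
pose u := \col_(k < m) s ^+ k.+1.
pose y x := dlsubmx (A1 x) - u *m ulsubmx (A1 x).
have [cA1 pA1 dA1] := lA1.
have [cul cur cdl cdr] := mxcont_sub cA1.
have cy : mxcont y.
  apply: mxcont_add => //.
  rewrite (_ : (fun x => _) = (fun x => (- u) *m ulsubmx (A1 x))); last first.
    by apply/funext => x; rewrite mulNmx.
  by apply: mxcont_mul => //; exact: mxcont_cst.
have py x : y (x + 1) = y x by rewrite /y pA1.
have y0 x : y x != 0.
  apply/eqP => /eqP; rewrite subr_eq0 => /eqP yx.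
  have /eqP := ws x (w x 0 0); apply; apply/colP => i; rewrite !mxE.
  case: (split_ordP (i : 'I_(1 + m))) => k ->.
    by rewrite ord1 lshift0 expr0 mulr1.
  have /colP/(_ k) := yx; rewrite !mxE big_ord1 !mxE /=.
  by rewrite lshift0 mulrC.
pose q x := (y x)^T *m y x.
have q0 x : 0 < q x 0 0 by exact: sqr_norm_gt0.
(* Chosen so that adding [f x *m y x] to the top entry gives 1; the last shear, by [- y x], then
   clears the entries below. *)
pose f x := ((1 - ulsubmx (A1 x) 0 0) / q x 0 0) *: (y x)^T.
have cf : mxcont f.
  apply: mxcont_scale; last exact: mxcont_tr.
  apply: continuous_mul.
    apply: continuous_add; first exact: continuous_cst.
    exact: continuous_opp.
  apply: continuous_inv; first by move=> x; rewrite gt_eqF.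
  by apply: mxcont_mul => //; exact: mxcont_tr.
have pf x : f (x + 1) = f x by rewrite /f /q py pA1.
have cNy : mxcont (fun x => - y x).
  rewrite (_ : (fun x => _) = (fun x => (-1) *: y x)); last first.
    by apply/funext => x; rewrite scaleN1r.
  by apply: mxcont_scale => //; exact: continuous_cst.
have pNy x : - y (x + 1) = - y x by rewrite py.
have H := homotopic_mul (unipL (fun x => - y x) cNy pNy)
  (homotopic_mul (unipU _ cf pf)
    (homotopic_mul (unipL (fun=> - u) (@mxcont_cst _ _ _ _ _) (fun=> erefl))
      (homotopic_refl lA1))).
set A1' := (fun _ => _) in H.
set A2 := (fun _ => _) in H.
have A1E : A1' = A1 by apply/funext => x; rewrite /A1' !mul1mx.
rewrite {}A1E in H.
have lA2 := homotopic_loopr H; have [cA2 pA2 dA2] := lA2.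
have A2E x : A2 x = block_mx 1%:M (ursubmx (A2 x)) 0 (drsubmx (A2 x)).
  have fy : ulsubmx (A1 x) + f x *m y x = 1%:M.
    rewrite /f -scalemxAl -/(q x); apply/matrixP => i j.
    rewrite !ord1 [LHS]mxE [X in _ + X]mxE divfK ?gt_eqF// addrC subrK.
    by rewrite mxE.
  have E : A2 x = block_mx 1%:M 0 (- y x) 1%:M *m (block_mx 1%:M (f x) 0 1%:M *m
    block_mx (ulsubmx (A1 x)) (ursubmx (A1 x)) (y x)
      (drsubmx (A1 x) - u *m ursubmx (A1 x))).
    rewrite /A2; congr (_ *m (_ *m _)).
    rewrite -{1}[A1 x]submxK mulmx_block !mul1mx !mul0mx !addr0 !mulNmx.
    by rewrite (addrC (- _)) (addrC (- _)).
  have {}E : A2 x = block_mx 1%:M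
      (ursubmx (A1 x) + f x *m (drsubmx (A1 x) - u *m ursubmx (A1 x))) 0
      (- y x *m (ursubmx (A1 x) + f x *m (drsubmx (A1 x) - u *m ursubmx (A1 x)))
        + (drsubmx (A1 x) - u *m ursubmx (A1 x))).
    rewrite E [X in _ *m X]mulmx_block !mul1mx !mul0mx !add0r fy.
    by rewrite mulmx_block !mul1mx !mul0mx !addr0 mulmx1 addNr.
  by rewrite {1}E E block_mxKur block_mxKdr.
have lB : loop (fun x => drsubmx (A2 x)).
  split=> [|x|x]; first by have [] := mxcont_sub cA2.
    by rewrite pA2.
  by have := dA2 x; rewrite {1}A2E det_ublock det1 mul1r.
exists (fun x => drsubmx (A2 x)); split=> //.
apply: homotopic_trans AA1 _; apply: homotopic_trans H _.
move: lA2; rewrite {1 2}(_ : A2 = fun x => block_mx 1%:M (ursubmx (A2 x)) 0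
  (drsubmx (A2 x))); last exact/funext.
by move=> lA2; apply: homotopic_ublock.
Qed.

Lemma homotopic_double1 n (A : R -> 'M[R]_n.+3) :
  loop A -> homotopic (fun x => A (2 * x)) (fun=> 1%:M).
Proof.
elim: n A => [|n IH] A lA.
  have [B [lB AB]] := @homotopic_reduce 2 A isT lA.
  have l1 : loop (fun _ : R => 1%:M : 'M[R]_1) by apply: loop_cst; rewrite det1.
  have [lr Br] := homotopic_rho2 lB.
  apply: homotopic_trans (homotopic_double AB) _.
  apply: homotopic_trans (homotopic_rho_double1 lr).
  exact: (homotopic_block (homotopic_refl l1) (homotopic_double Br)).
have [B [lB AB]] := @homotopic_reduce n.+3 A isT lA.
have l1 : loop (fun _ : R => 1%:M : 'M[R]_1) by apply: loop_cst; rewrite det1.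
apply: homotopic_trans (homotopic_double AB) _.
have := homotopic_block (homotopic_refl l1) (IH _ lB).
by rewrite -scalar_mx_block.
Qed.

End reduction.

(** * Isotopies that are C^1 in time *)

Section smooth_step.
Context {R : realType}.

Definition ramp (t : R) : R := Order.max 0 t.

Lemma ramp_continuous : continuous ramp.
Proof. by move=> t; exact: (continuous_max (cvg_cst _) cvg_id). Qed.

Lemma ramp_le0 t : t <= 0 -> ramp t = 0.
Proof. by move=> t0; rewrite /ramp max_l. Qed.

Lemma ramp_ge0 t : 0 <= t -> ramp t = t.
Proof. by move=> t0; rewrite /ramp max_r. Qed.

Lemma is_derive_add (f g : R -> R) (t df dg : R) :
  is_derive t (1 : R) f df -> is_derive t (1 : R) g dg ->
  is_derive t (1 : R) (fun t => f t + g t) (df + dg).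
Proof. by move=> hf hg; exact: is_deriveD. Qed.

Lemma is_derive_mul (f g : R -> R) (t df dg : R) :
  is_derive t (1 : R) f df -> is_derive t (1 : R) g dg ->
  is_derive t (1 : R) (fun t => f t * g t) (df * g t + f t * dg).
Proof.
move=> hf hg; suff -> : df * g t + f t * dg = f t *: dg + g t *: df.
  exact: is_deriveM.
by rewrite /GRing.scale/=; ring.
Qed.

Lemma is_derive_inv (f : R -> R) (t df : R) : f t != 0 ->
  is_derive t (1 : R) f df ->
  is_derive t (1 : R) (fun t => (f t)^-1) (- df * (f t)^-1 * (f t)^-1).
Proof.
move=> f0 hf; suff -> : - df * (f t)^-1 * (f t)^-1 = - (f t) ^- 2 *: df.
  exact: is_deriveV.
by rewrite /GRing.scale/= expr2; field.
Qed.

Lemma is_derive_const (c t : R) : is_derive t (1 : R) (fun=> c) 0.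
Proof. exact: is_derive_cst. Qed.

Lemma is_derive_subst (f g : R -> R) (t df dg : R) :
  is_derive t (1 : R) g dg -> is_derive (g t) (1 : R) f df ->
  is_derive t (1 : R) (fun t => f (g t)) (df * dg).
Proof. by move=> hg hf; exact: is_derive1_comp. Qed.

Lemma is_derive_translate (f : R -> R) (a t df : R) :
  is_derive (t + a) (1 : R) f df -> is_derive t (1 : R) (fun t => f (t + a)) df.
Proof.
move=> hf; rewrite -[df]mulr1; apply: is_derive_subst => //.
rewrite -[X in is_derive _ _ _ X]addr0.
by apply: is_derive_add.
Qed.

(** Only t = 0 is delicate: there the difference quotient at h is bounded by the modulus of h. *)
Lemma is_derive_sqr_ramp (t : R) :
  is_derive t (1 : R) (fun t => ramp t ^+ 2) (2 * ramp t).
Proof.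
have [t0|t0|->] := ltgtP t 0.
- rewrite ramp_le0 ?(ltW t0)// mulr0.
  apply: (@near_eq_is_derive _ _ _ (cst 0)).
  near=> u; rewrite ramp_le0 ?expr0n//.
  by apply: ltW; near: u; exact: lt_nbhsl.
- rewrite ramp_ge0 ?(ltW t0)//.
  apply: (@near_eq_is_derive R R R (fun u : R => u * u)).
    near=> u; rewrite ramp_ge0//.
    by apply: ltW; near: u; exact: lt_nbhsr.
  rewrite (_ : 2 * t = 1 * t + t * 1); last by ring.
  by apply: is_derive_mul; exact: is_derive_id.
rewrite ramp_ge0// mulr0.
have H : h^-1 *: (ramp (h *: 1 + 0) ^+ 2 - ramp 0 ^+ 2)
    @[h --> (0 : R)^'] --> (0 : R).
  apply/cvgr0Pnorm_lt => e e0; near=> h.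
  have h0 : h != 0 by near: h; exact: nbhs_dnbhs_neq.
  have he : `|h| < e by near: h; exact: dnbhs0_lt.
  apply: le_lt_trans he => /=.
  rewrite addr0 [_ *: 1]mulr1 (ramp_ge0 (lexx 0)) expr0n subr0.
  have [h1|h1] := leP h 0.
    by rewrite ramp_le0// expr0n scaler0 normr0.
  by rewrite ramp_ge0 ?(ltW h1)// /GRing.scale/= expr2 mulKf.
apply: DeriveDef; first exact: cvgP H.
exact: cvg_lim H.
Unshelve. all: by end_near. Qed.

(* C^1 and piecewise quadratic, from [0] to [1] on the unit interval. *)
Definition step (t : R) : R :=
  2 * ramp t ^+ 2 + (- 4 * ramp (t + - 2^-1) ^+ 2 + 2 * ramp (t + - 1) ^+ 2).

Definition dstep (t : R) : R :=
  4 * ramp t + (- 8 * ramp (t + - 2^-1) + 4 * ramp (t + - 1)).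

Lemma is_derive_step (t : R) : is_derive t (1 : R) step (dstep t).
Proof.
have H (k a : R) : is_derive t (1 : R) (fun t => k * ramp (t + a) ^+ 2)
    (k * (2 * ramp (t + a))).
  rewrite [X in is_derive _ _ _ X](_ : _ =
    0 * ramp (t + a) ^+ 2 + k * (2 * ramp (t + a)));
    last by rewrite mul0r add0r.
  apply: is_derive_mul.
  apply: (@is_derive_translate (fun t => ramp t ^+ 2)).
  exact: is_derive_sqr_ramp.
have := is_derive_add (H 2 0) (is_derive_add (H (- 4) (- 2^-1)) (H 2 (- 1))).
rewrite (_ : (fun t => _) = step); last first.
  by apply/funext => u; rewrite /step addr0.
by congr is_derive; rewrite /dstep addr0; ring.
Qed.

Lemma dstep_continuous : continuous dstep.
Proof.
have cr a : continuous (fun t : R => ramp (t + a)).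
  move=> t; apply: (@continuous_comp _ _ _ (fun t => t + a) ramp).
    by apply: continuous_add; [exact: continuous_id|exact: continuous_cst].
  exact: ramp_continuous.
by repeat (apply: continuous_add || apply: continuous_mul);
  (exact: continuous_cst || exact: ramp_continuous || exact: cr).
Qed.

Lemma step_continuous : continuous step.
Proof.
move=> t; apply: differentiable_continuous; apply/derivable1_diffP.
by have [] := is_derive_step t.
Qed.

Lemma step_le0 t : t <= 0 -> step t = 0.
Proof. by move=> t0; rewrite /step !ramp_le0; try lra; ring. Qed.

Lemma step_ge1 t : 1 <= t -> step t = 1.
Proof. by move=> t0; rewrite /step !ramp_ge0; try lra; field. Qed.

Lemma dstep_le0 t : t <= 0 -> dstep t = 0.
Proof. by move=> t0; rewrite /dstep !ramp_le0; try lra; ring. Qed.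

Lemma dstep_ge1 t : 1 <= t -> dstep t = 0.
Proof. by move=> t0; rewrite /dstep !ramp_ge0; try lra; field. Qed.

Lemma step_itv t : 0 <= step t <= 1.
Proof.
have [t0|t0] := leP t 0; first by rewrite step_le0// lexx ler01.
have [t1|t1] := leP 1 t; first by rewrite step_ge1// lexx ler01.
rewrite /step (ramp_ge0 (ltW t0)) (@ramp_le0 (t + - 1)); last by lra.
have [t2|t2] := leP t 2^-1.
  by rewrite ramp_le0; [apply/andP; split; nra|lra].
by rewrite ramp_ge0; [apply/andP; split; nra|lra].
Qed.

End smooth_step.

(** * Replacing a homotopy in GL_d^+ by an isotopy in SL_d *)

Section time_derivative.
Context {R : realType}.

Definition tC1 (g : R * R -> R) := exists dg : R * R -> R,
  [/\ continuous g, continuous dg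
    & forall x t, is_derive t (1 : R) (fun t => g (x, t)) (dg (x, t))].

Lemma tC1_space (f : R -> R) : continuous f -> tC1 (fun p => f p.1).
Proof.
move=> cf; exists (fun=> 0); split;
  last by move=> x t; exact: (is_derive_const (f x) t).
  move=> p; apply: (@continuous_comp _ _ _ fst f); last exact: cf.
  exact: continuous_fst.
exact: continuous_cst.
Qed.

Lemma tC1_cst (a : R) : tC1 (fun=> a).
Proof. exact: (tC1_space (@continuous_cst R R a)). Qed.

Lemma tC1_step : tC1 (fun p => step p.2).
Proof.
exists (fun p => dstep p.2); split; last by move=> x t; exact: is_derive_step.
  move=> p; apply: (@continuous_comp _ _ _ snd step);
    last exact: step_continuous.
  exact: continuous_snd.
move=> p; apply: (@continuous_comp _ _ _ snd dstep);
    last exact: dstep_continuous.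
exact: continuous_snd.
Qed.

Lemma tC1_add (f g : R * R -> R) : tC1 f -> tC1 g -> tC1 (fun p => f p + g p).
Proof.
move=> [df [cf cdf hf]] [dg [cg cdg hg]].
exists (fun p => df p + dg p); split; [exact: continuous_add..|].
by move=> x t; exact: (is_derive_add (hf x t) (hg x t)).
Qed.

Lemma tC1_mul (f g : R * R -> R) : tC1 f -> tC1 g -> tC1 (fun p => f p * g p).
Proof.
move=> [df [cf cdf hf]] [dg [cg cdg hg]].
exists (fun p => df p * g p + f p * dg p); split; first exact: continuous_mul.
  by apply: continuous_add; exact: continuous_mul.
by move=> x t; exact: (is_derive_mul (hf x t) (hg x t)).
Qed.

Lemma tC1_inv (f : R * R -> R) : (forall p, f p != 0) -> tC1 f ->
  tC1 (fun p => (f p)^-1).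
Proof.
move=> f0 [df [cf cdf hf]].
have ci := continuous_inv f0 cf.
exists (fun p => - df p * (f p)^-1 * (f p)^-1); split=> //.
  by do 2?apply: continuous_mul => //; exact: continuous_opp.
by move=> x t; exact: (is_derive_inv (f0 (x, t)) (hf x t)).
Qed.

Lemma tC1_sum (I : Type) (r : seq I) (P : pred I) (F : I -> R * R -> R) :
  (forall i, tC1 (F i)) -> tC1 (fun x => \sum_(i <- r | P i) F i x).
Proof.
move=> cF; elim: r => [|i r IH].
  by under eq_fun do rewrite big_nil; exact: tC1_cst.
under eq_fun do rewrite big_cons.
by case: (P i) => //; exact: tC1_add.
Qed.

Lemma tC1_prod (I : Type) (r : seq I) (P : pred I) (F : I -> R * R -> R) :
  (forall i, tC1 (F i)) -> tC1 (fun x => \prod_(i <- r | P i) F i x).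
Proof.
move=> cF; elim: r => [|i r IH].
  by under eq_fun do rewrite big_nil; exact: tC1_cst.
under eq_fun do rewrite big_cons.
by case: (P i) => //; exact: tC1_mul.
Qed.

Definition mxtC1 m n (F : R * R -> 'M[R]_(m, n)) :=
  forall i j, tC1 (fun p => F p i j).

Lemma mxtC1_space m n (F : R -> 'M[R]_(m, n)) :
  mxcont F -> mxtC1 (fun p => F p.1).
Proof. by move=> cF i j; exact: (tC1_space (cF i j)). Qed.

Lemma mxtC1_add m n (F G : R * R -> 'M[R]_(m, n)) :
  mxtC1 F -> mxtC1 G -> mxtC1 (fun p => F p + G p).
Proof.
by move=> cF cG i j; under eq_fun do rewrite mxE; exact: tC1_add.
Qed.

Lemma mxtC1_scale m n f (F : R * R -> 'M[R]_(m, n)) :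
  tC1 f -> mxtC1 F -> mxtC1 (fun p => f p *: F p).
Proof.
by move=> cf cF i j; under eq_fun do rewrite mxE; exact: tC1_mul.
Qed.

Lemma mxtC1_mul m n p (F : R * R -> 'M[R]_(m, n)) (G : R * R -> 'M[R]_(n, p)) :
  mxtC1 F -> mxtC1 G -> mxtC1 (fun p => F p *m G p).
Proof.
move=> cF cG i j; under eq_fun do rewrite mxE.
by apply: tC1_sum => k; exact: tC1_mul.
Qed.

Lemma tC1_det m (F : R * R -> 'M[R]_m) : mxtC1 F -> tC1 (fun p => \det (F p)).
Proof.
move=> cF; apply: tC1_sum => s; apply: tC1_mul; first exact: tC1_cst.
exact: tC1_prod.
Qed.

(** Dividing only the first row by the determinant involves no d-th root. *)
Definition normalize m (M : 'M[R]_m.+1) : 'M[R]_m.+1 :=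
  diag_mx (\row_j if j == 0 then (\det M)^-1 else 1) *m M.

Lemma det_normalize m (M : 'M[R]_m.+1) : \det M != 0 -> \det (normalize M) = 1.
Proof.
move=> M0; rewrite det_mulmx det_diag (bigD1 0)//= mxE eqxx.
by rewrite big1 ?mulr1 ?mulVf// => i /negbTE i0; rewrite mxE i0.
Qed.

Lemma normalize_id m (M : 'M[R]_m.+1) : \det M = 1 -> normalize M = M.
Proof.
move=> M1; rewrite /normalize M1 invr1.
rewrite (_ : \row_j _ = const_mx 1) ?diag_const_mx ?mul1mx//.
by apply/rowP => j; rewrite !mxE if_same.
Qed.

Lemma mxcont_normalize (T : topologicalType) m (F : T -> 'M[R]_m.+1) :
  (forall p, \det (F p) != 0) -> mxcont F -> mxcont (fun p => normalize (F p)).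
Proof.
move=> F0 cF i j; under eq_fun do rewrite /normalize mul_diag_mx !mxE.
apply: continuous_mul => //; case: (i == 0); last exact: continuous_cst.
by apply: continuous_inv => //; exact: continuous_det.
Qed.

Lemma mxtC1_normalize m (F : R * R -> 'M[R]_m.+1) :
  (forall p, \det (F p) != 0) -> mxtC1 F -> mxtC1 (fun p => normalize (F p)).
Proof.
move=> F0 cF i j; under eq_fun do rewrite /normalize mul_diag_mx !mxE.
apply: tC1_mul => //; case: (i == 0); last exact: tC1_cst.
by apply: tC1_inv => //; exact: tC1_det.
Qed.

Definition isotopic1 m (B : R -> 'M[R]_m) := exists F : R * R -> 'M[R]_m,
  [/\ mxtC1 F, forall x t, F (x + 1, t) = F (x, t),
      forall p, \det (F p) = 1, forall x, F (x, 0) = 1%:M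
    & forall x, F (x, 1) = B x].

(** The isotopy to [B] is multiplied on the right by the normalized path from 1 to [B^-1 C]. Both
    factors run over the same unit of time, so nothing is concatenated. *)
Lemma isotopic1_step m (B C : R -> 'M[R]_m.+1) :
  isotopic1 B -> loop B -> loop C -> (forall x, \det (B x) = 1) ->
  (forall x, \det (C x) = 1) ->
  (forall x s, 0 <= s <= 1 -> 0 < \det (B x + s *: (C x - B x))) ->
  isotopic1 C.
Proof.
move=> [F [cF pF dF F0 F1]] [cB pB dB0] [cC pC _] dB dC hs.
pose D x := invmx (B x) *m (C x - B x).
have cD : mxcont D.
  apply: mxcont_mul; first exact: mxcont_inv.
  apply: mxcont_add => // i j; under eq_fun do rewrite mxE.
  exact: continuous_opp.
have pD x : D (x + 1) = D x by rewrite /D pB pC.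
have uB x : B x \in unitmx by apply: unitmx_det_gt0.
pose S (p : R * R) := 1%:M + step p.2 *: D p.1.
have dS p : \det (S p) != 0.
  (* [B S] is a point of the segment from [B] to [C], because [step] stays in the unit interval. *)
  have : 0 < \det (B p.1 *m S p).
    rewrite /S /D mulmxDr mulmx1 -scalemxAr mulKVmx//.
    by apply: hs; exact: step_itv.
  by rewrite det_mulmx dB mul1r => /lt0r_neq0.
have cS : mxtC1 S.
  apply: mxtC1_add; first by move=> i j; exact: tC1_cst.
  by apply: mxtC1_scale; [exact: tC1_step|exact: mxtC1_space].
exists (fun p => F p *m normalize (S p)); split.
- by apply: mxtC1_mul => //; exact: mxtC1_normalize.
- by move=> x t; rewrite pF /S /= pD.
- by move=> p; rewrite det_mulmx dF det_normalize// mulr1.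
- move=> x; rewrite F0 /S /= step_le0// scale0r addr0 mul1mx.
  by rewrite normalize_id// det1.
- move=> x; rewrite F1 /S /= step_ge1// scale1r.
  have E : B x *m (1%:M + D x) = C x.
    by rewrite mulmxDr mulmx1 mulKVmx// addrC subrK.
  rewrite normalize_id//.
  by have := dC x; rewrite -E det_mulmx dB mul1r.
Qed.

(* Near the diagonal in time a homotopy is joined to itself by segments, so   *)
(* a fine enough subdivision replaces it by a product of C^1 isotopies.       *)
Lemma homotopic_isotopic1 m (B : R -> 'M[R]_m.+1) :
  (forall x, \det (B x) = 1) -> homotopic B (fun=> 1%:M) -> isotopic1 B.
Proof.
move=> dB /homotopic_sym [H0 [cH0 pH0 dH0 H00 H01]].
have dH0' p : \det (H0 p) != 0 by rewrite gt_eqF.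
pose H p := normalize (H0 p).
have cH : mxcont H by exact: mxcont_normalize.
have pH x t : H (x + 1, t) = H (x, t) by rewrite /H pH0.
have dH p : \det (H p) = 1 by rewrite det_normalize.
have lH t : loop (fun x => H (x, t)).
  split=> [|x|x]; [|exact: pH|by rewrite dH].
  apply: mxcont_comp cH; apply: continuous_pairf; first exact: continuous_id.
  by move=> x; exact: cvg_cst.
(* With p = (x, t, s, h): the determinant at parameter s on the segment from H(x, t) to H(x, t + h).
   It is 1 at h = 0, and compactness yields one mesh valid for all x, t, s. *)
pose f (p : (R * R * R) * R) := \det (H (p.1.1.1, p.1.1.2) + p.1.2 *:
   (H (p.1.1.1, p.1.1.2 + p.2) - H (p.1.1.1, p.1.1.2))).
have c11 : continuous (fun p : (R * R * R) * R => p.1).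
  exact: continuous_fst.
have cp (g : (R * R * R) -> R) : continuous g ->
    continuous (fun p : (R * R * R) * R => g p.1).
  by move=> cg p; apply: (@continuous_comp _ _ _ fst g); [exact: c11|exact: cg].
have cpp (g : (R * R) -> R) : continuous g ->
    continuous (fun p : (R * R * R) * R => g p.1.1).
  move=> cg; apply: (cp (fun q => g q.1)) => p.
  by apply: (@continuous_comp _ _ _ fst g); [exact: continuous_fst|exact: cg].
have cx : continuous (fun p : (R * R * R) * R => p.1.1.1).
  by apply: cpp; exact: continuous_fst.
have ct : continuous (fun p : (R * R * R) * R => p.1.1.2).
  by apply: cpp; exact: continuous_snd.
have cs : continuous (fun p : (R * R * R) * R => p.1.2).
  by apply: cp; exact: continuous_snd.
have cHt : mxcont (fun p : (R * R * R) * R => H (p.1.1.1, p.1.1.2)).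
  by apply: mxcont_comp cH; exact: continuous_pairf.
have cf : continuous f.
  apply: continuous_det; apply: mxcont_add => //; apply: mxcont_scale => //.
  apply: mxcont_add.
    apply: mxcont_comp cH; apply: continuous_pairf => //.
    by apply: continuous_add => //; exact: continuous_snd.
  by move=> i j; under eq_fun do rewrite mxE; apply: continuous_opp; exact: cHt.
pose I := [set` `[0, 1]%R] : set R.
have cI : compact I by exact: segment_compact.
have [|e e0 he] := compact_pos_near
  (compact_setX (compact_setX cI cI) cI) cf.
  by move=> x _; rewrite /f /= addr0 subrr scaler0 addr0 dH.
pose N := (Num.truncn e^-1).+1.
have N0 : 0 < N%:R :> R by rewrite ltr0n.
have Ne : N%:R^-1 < e by rewrite invf_plt ?posrE//; apply: truncnS_gt.
have main k : (k <= N)%N -> isotopic1 (fun x => H (x, k%:R / N%:R)).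
  elim: k => [_|k IH kN].
    exists (fun=> 1%:M); split=> //.
    - by move=> i j; exact: tC1_cst.
    - by move=> _; exact: det1.
    - by move=> x; rewrite mul0r /H H00 normalize_id// det1.
  apply: isotopic1_step (IH (ltnW kN)) _ _ _ _ _ => // x s s01.
  pose x' := x - (Num.floor x)%:~R.
  have pHz t : H (x, t) = H (x', t).
    rewrite /x' -rmorphN/=.
    by rewrite (periodicz (f := fun x => H (x, t)) (fun x => pH x t)).
  have := he (x', k%:R / N%:R, s) (N%:R^-1).
  rewrite /f /= -!pHz gtr0_norm ?invr_gt0//.
  rewrite (_ : k%:R / N%:R + N%:R^-1 = k.+1%:R / N%:R); last first.
    by rewrite -natr1 mulrDl mul1r.
  apply=> //; split=> //; split; rewrite /I /= in_itv/=.
    rewrite subr_ge0 floor_le/= lerBlDl -intrD1 ltW//.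
    exact: floorD1_gt.
  by rewrite divr_ge0//= ler_pdivrMr// mul1r ler_nat ltnW.
have := main N (leqnn N); rewrite divff ?gt_eqF//.
suff -> : (fun x => H (x, 1)) = B by [].
by apply/funext => x; rewrite /H H01 normalize_id.
Qed.

End time_derivative.

(** * Matrix derivatives *)

Section matrix_derivative.
Context {R : realType}.

Lemma is_derive_bigsum (I : Type) (r : seq I) (f : I -> R -> R)
    (df : I -> R) t :
  (forall i, is_derive t (1 : R) (f i) (df i)) ->
  is_derive t (1 : R) (fun t => \sum_(i <- r) f i t) (\sum_(i <- r) df i).
Proof.
move=> h; elim: r => [|i r IH].
  rewrite big_nil; under eq_fun do rewrite big_nil.
  exact: is_derive_const.
rewrite big_cons; under eq_fun do rewrite big_cons.
exact: is_derive_add.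
Qed.

Lemma is_derive_bigprod (I : eqType) (r : seq I) (f : I -> R -> R)
    (df : I -> R) t : uniq r ->
  (forall i, is_derive t (1 : R) (f i) (df i)) ->
  is_derive t (1 : R) (fun t => \prod_(i <- r) f i t)
    (\sum_(i <- r) df i * \prod_(k <- r | k != i) f k t).
Proof.
move=> + h; elim: r => [_|a r IH /= /andP[ar ur]].
  rewrite big_nil; under eq_fun do rewrite big_nil.
  exact: is_derive_const.
under eq_fun do rewrite big_cons.
have -> : \sum_(i <- a :: r) df i * \prod_(k <- a :: r | k != i) f k t =
  df a * \prod_(i <- r) f i t +
  f a t * \sum_(i <- r) df i * \prod_(k <- r | k != i) f k t.
  rewrite big_cons big_cons eqxx; congr (df a * _ + _).
    rewrite big_seq_cond [RHS]big_seq; apply: eq_bigl => i.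
    by have [->|] := eqVneq i a; rewrite ?(negbTE ar)// andbT.
  rewrite mulr_sumr !big_seq; apply: eq_bigr => i ir.
  rewrite big_cons ifT; first by rewrite mulrCA.
  by apply: contraNneq ar => ->.
exact: (is_derive_mul (h a) (IH ur)).
Qed.

Definition mxder m n (F : R -> 'M[R]_(m, n)) (t : R) (D : 'M[R]_(m, n)) :=
  forall i j, is_derive t (1 : R) (fun t => F t i j) (D i j).

Lemma mxder_is_derive m n (F : R -> 'M[R]_(m, n)) t D :
  mxder F t D -> is_derive t (1 : R) F D.
Proof.
move=> h.
have dF : derivable F t 1 by apply/derivable_mxP => i j; have [] := h i j.
apply: DeriveDef => //; rewrite derive_mx//; apply/matrixP => i j.
by rewrite mxE; have [] := h i j.
Qed.

Lemma mxder_cst m n (M : 'M[R]_(m, n)) t : mxder (fun=> M) t 0.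
Proof. by move=> i j; rewrite mxE; exact: is_derive_const. Qed.

Lemma mxder_mul m n p (F : R -> 'M[R]_(m, n)) (G : R -> 'M[R]_(n, p)) t D E :
  mxder F t D -> mxder G t E ->
  mxder (fun t => F t *m G t) t (D *m G t + F t *m E).
Proof.
move=> hF hG i j; rewrite !mxE -big_split/=.
under eq_fun do rewrite mxE.
by apply: is_derive_bigsum => k; exact: is_derive_mul.
Qed.

Lemma mxder_translate m n (F : R -> 'M[R]_(m, n)) a t D :
  mxder F (t + a) D -> mxder (fun t => F (t + a)) t D.
Proof.
by move=> h i j; exact: (@is_derive_translate _ (fun t => F t i j)).
Qed.

Lemma near_eq_mxder m n (F G : R -> 'M[R]_(m, n)) t D :
  (\near t, F t = G t) -> mxder F t D -> mxder G t D.
Proof.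
move=> h hF i j; apply: near_eq_is_derive (hF i j).
by apply: filterS h => u ->.
Qed.

(** Jacobi's formula. Differentiating the Leibniz sum replaces one row of [F t] at a time by that of
    [D]; expanding along this row gives a diagonal entry of [D *m \adj (F t)]. *)
Lemma is_derive_det m (F : R -> 'M[R]_m) t D : mxder F t D ->
  is_derive t (1 : R) (fun t => \det (F t)) (\tr (D *m \adj (F t))).
Proof.
move=> hF; rewrite /determinant.
have -> : \tr (D *m \adj (F t)) = \sum_(s : 'S_m)
    (-1) ^+ s * \sum_i D i (s i) * \prod_(k | k != i) F t k (s k).
  under [RHS]eq_bigr do rewrite mulr_sumr.
  rewrite exchange_big; apply: eq_bigr => i _ /=.
  pose M := \matrix_(k, j) if k == i then D k j else F t k j.
  transitivity (\det M).
    rewrite (expand_det_row _ i) mxE; apply: eq_bigr => j _.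
    rewrite !mxE eqxx; congr (_ * (_ * \det _)).
    by apply/matrixP => k l; rewrite !mxE eq_sym (negbTE (neq_lift _ _)).
  apply: eq_bigr => s _; congr (_ * _).
  rewrite (bigD1 i)//= !mxE eqxx; congr (_ * _).
  by apply: eq_bigr => k /negbTE ki; rewrite mxE ki.
apply: is_derive_bigsum => s.
have := is_derive_mul (is_derive_const ((-1) ^+ s) t)
  (@is_derive_bigprod _ (index_enum 'I_m) _ _ t (index_enum_uniq _)
     (fun i => hF i (s i))).
by rewrite mul0r add0r.
Qed.

Lemma trace_log_derivative m (F : R -> 'M[R]_m) t D :
  (forall t, \det (F t) = 1) ->
  mxder F t D -> \tr (D *m invmx (F t)) = 0.
Proof.
move=> dF hF; have := is_derive_det hF; under eq_fun do rewrite dF.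
move=> h; have [_ <-] := is_derive_const 1 t.
have [_ ->] := h; congr (\tr (_ *m _)).
rewrite /invmx dF invr1 scale1r ifT//.
by rewrite unitmxE dF unitr1.
Qed.

End matrix_derivative.

(** * Recursions for the discrete cocycle *)

Section step_maps.
Context {R : realType} {d : nat}.
Variables (a : R) (A : circle R -> 'M[R]_d).
Hypothesis A_SL : forall p, \det (A p) = 1.

Lemma SL_unit p : A p \in unitmx.
Proof. by rewrite unitmxE A_SL unitr1. Qed.

Lemma iter_circle_rot b n (p : circle R) :
  iter n (circle_rot b) p = circle_rot (n%:R * b) p.
Proof.
elim: n => [|n IH]; first by rewrite mul0r circle_rot0.
by rewrite iterS IH circle_rotD -natr1 mulrDl mul1r.
Qed.

Lemma nstep_mapS (n : int) p : nstep_map a A (n + 1) p =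
  A (circle_rot (n%:~R * a) p) *m nstep_map a A n p.
Proof.
case: n => [m|[|m]].
- by rewrite -PoszD addn1 /= iter_circle_rot.
- rewrite (_ : Negz 0 + 1 = 0)//= mulmx1 (_ : _%:~R * a = - a).
    by rewrite mulmxV// SL_unit.
  by rewrite NegzE rmorphN/= mulN1r.
rewrite (_ : Negz m.+1 + 1 = Negz m); last by lia.
rewrite [in RHS]/nstep_map -[bwd_steps _ _ m.+2 p]/(_ *m bwd_steps a A m.+1 p).
rewrite iter_circle_rot (_ : (Negz m.+1)%:~R * a = m.+2%:R * - a); last first.
  by rewrite NegzE rmorphN/= mulrN mulNr.
by rewrite mulKVmx// SL_unit.
Qed.

Lemma det_nstep_map n p : \det (nstep_map a A n p) = 1.
Proof.
case: n => [m|m]; rewrite /nstep_map.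
  by elim: m => [|m IH] /=; rewrite ?det1// det_mulmx A_SL mul1r.
elim: m.+1 => {m} [|m IH] /=; rewrite ?det1// det_mulmx IH mulr1.
by rewrite det_inv A_SL invr1.
Qed.

(** The cocycle identity with the first step split off; needed when a point of height 0 on the torus
    is represented at height 1. *)
Lemma nstep_mapSr (n : int) p : nstep_map a A (n + 1) p =
  nstep_map a A n (circle_rot a p) *m A p.
Proof.
have E (k : int) : circle_rot (k%:~R * a) (circle_rot a p) =
    circle_rot ((k + 1)%:~R * a) p.
  by rewrite circle_rotD intrD mulrDl mul1r addrC.
elim/int_rect: n => [|n IH|n IH].
- by rewrite add0r /= mulmx1 mul1mx.
- by rewrite nstep_mapS intS [1 + _]addrC [in RHS]nstep_mapS E IH mulmxA.
- apply: (can_inj (mulKmx (SL_unit (circle_rot ((- n.+1%:Z + 1)%:~R * a) p)))).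
  rewrite -nstep_mapS -[in RHS]E mulmxA -nstep_mapS.
  by rewrite (_ : - n.+1%:Z + 1 = - n%:Z)//; lia.
Qed.

End step_maps.

(** * The suspended cocycle *)

Section smooth_isotopy.
Context {R : realType}.

Definition flat_isotopy m (B : R -> 'M[R]_m) (F dF : R -> R -> 'M[R]_m) :=
  [/\ mxcont (fun p : R * R => F p.1 p.2) /\
      mxcont (fun p : R * R => dF p.1 p.2),
      forall x, F (x + 1) = F x /\ dF (x + 1) = dF x,
      forall x t, mxder (F x) t (dF x t) /\ \det (F x t) = 1,
      forall x t, t <= 0 -> F x t = 1%:M /\ dF x t = 0
    & forall x t, 1 <= t -> F x t = B x /\ dF x t = 0].

(** Reparametrizing time by [step] freezes the isotopy outside the unit interval and, by the chain
    rule, makes its derivative vanish there. *)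
Lemma flat_isotopyP m (B : R -> 'M[R]_m) :
  isotopic1 B -> exists F dF, flat_isotopy B F dF.
Proof.
move=> [F [cF pF dF F0 F1]].
have /choice[D HD] : forall ij : 'I_m * 'I_m, exists dg : R * R -> R,
    [/\ continuous (fun p => F p ij.1 ij.2), continuous dg
      & forall x t, is_derive t (1 : R) (fun t => F (x, t) ij.1 ij.2)
          (dg (x, t))].
  by move=> [i j]; exact: (cF i j).
(* The time derivative inherits periodicity because derivatives are unique. *)
have pD ij x t : D ij (x + 1, t) = D ij (x, t).
  have [_ _ h] := HD ij; have [_ <-] := h (x + 1) t; have [_ <-] := h x t.
  by congr derive; apply/funext => u; rewrite pF.
pose E p : 'M[R]_m := \matrix_(i, j) D (i, j) p.
have cs : continuous (fun p : R * R => (p.1, step p.2)).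
  apply: continuous_pairf; first exact: continuous_fst.
  move=> p; apply: (@continuous_comp _ _ _ snd step);
    last exact: step_continuous.
  exact: continuous_snd.
exists (fun x t => F (x, step t)), (fun x t => dstep t *: E (x, step t)); split.
- split.
    apply: (mxcont_comp (g := fun p => (p.1, step p.2)) cs) => i j.
    by have [] := HD (i, j).
  apply: mxcont_scale.
    move=> p; apply: (@continuous_comp _ _ _ snd dstep);
    last exact: dstep_continuous.
    exact: continuous_snd.
  apply: (mxcont_comp (g := fun p => (p.1, step p.2)) cs) => i j.
  by under eq_fun do rewrite mxE; have [] := HD (i, j).
- move=> x; split; apply/funext => t; first by rewrite pF.
  by congr (_ *: _); apply/matrixP => i j; rewrite !mxE pD.
- move=> x t; split=> // i j; rewrite !mxE mulrC.
  have [_ _ h] := HD (i, j).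
  exact: (is_derive_subst (f := fun t => F (x, t) i j)
    (is_derive_step t) (h _ _)).
- by move=> x t t0; rewrite step_le0// dstep_le0// F0 scale0r.
- by move=> x t t0; rewrite step_ge1// dstep_ge1// F1 scale0r.
Qed.

End smooth_isotopy.

Local Open Scope quotient_scope.

(** * Continuity on the circle and the cylinder *)

Section circle_topology.
Context {R : realType}.
Local Notation cpi := (\pi_(circle R)).

Lemma circle_piD1 (x : R) : cpi (x + 1) = cpi x.
Proof. by apply/circle_eqP; rewrite addrAC subrr add0r rpred1. Qed.

Lemma circle_reprP (x : R) : exists k : int, repr (cpi x) = x + k%:~R.
Proof.
have /circle_eqP/intrP[k hk] : cpi (repr (cpi x)) = cpi x by rewrite reprK.
by exists k; rewrite -hk addrC subrK.
Qed.

(** The saturation of an open set is the union of its integer translates. *)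
Lemma circle_pi_open (x : R) (U : set R) : nbhs x U -> nbhs (cpi x) (cpi @` U).
Proof.
rewrite {1}nbhsE => -[V [oV Vx] VU].
rewrite nbhsE; exists (cpi @` V); last exact: image_subset.
split; last by exists x.
rewrite /open/= /quotient_open openE => y [z Vz] /circle_eqP/intrP[k hk].
have ct : continuous (fun u : R => u + k%:~R).
  by apply: continuous_add; [exact: continuous_id|exact: continuous_cst].
have : nbhs (y + k%:~R) V.
  by rewrite -hk addrC subrK; apply: open_nbhs_nbhs.
move=> /(ct y) nV; apply: (@filterS _ (nbhs y) _ _ _ _ nV) => u /= Vu.
exists (u + k%:~R) => //.
by apply/circle_eqP; rewrite addrAC subrr add0r intr_int.
Qed.

(** The choice of representatives [repr] need not be continuous, but periodicity of [h] hides its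
    integer jumps, and openness of the projection supplies the neighbourhoods. *)
Lemma cylinder_continuous (h : R * R -> R) : continuous h ->
  (forall x t, h (x + 1, t) = h (x, t)) ->
  continuous (fun u : cylinder R => h (repr u.1, \val u.2)).
Proof.
move=> ch ph [p r] S /= /(ch (repr p, \val r)) [[U W] /= [nU nW] UW].
have cval : continuous (\val : unit_itv R -> R) by exact: initial_continuous.
exists (cpi @` U, \val @^-1` W) => /=.
  split; last exact: cval.
  by have := circle_pi_open nU; rewrite reprK.
move=> [q s] /= [[x Ux <-] Ws]; have [k ->] := circle_reprP x.
rewrite (periodicz (f := fun x => h (x, \val s)) (fun x => ph x _)).
exact: (UW (x, \val s)).
Qed.

End circle_topology.

(** * Gluing the isotopies along the flow *)

Section suspended_cocycle.
Context {R : realType} {m : nat}.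
Variables (a : R) (A : circle R -> 'M[R]_m).
Hypothesis A_SL : forall p, \det (A p) = 1.
Variables F dF : R -> R -> 'M[R]_m.
Hypothesis HF : flat_isotopy (fun x => A (\pi_(circle R) (2 * x))) F dF.
Local Notation cpi := (\pi_(circle R)).
Local Notation b := (a / 2).

(** The solution issued from height 0 over [x]: the completed turns give the discrete product at 2x,
    and the current turn contributes the isotopy at the rotated point. *)
Definition long_map (x tau : R) : 'M[R]_m :=
  F (x + (Num.floor tau)%:~R * b) (tau - (Num.floor tau)%:~R) *m
  nstep_map a A (Num.floor tau) (cpi (2 * x)).

Definition gen (x t : R) : 'M[R]_m := dF x t *m invmx (F x t).

Lemma detF x t : \det (F x t) = 1.
Proof. by have [_ _ /(_ x t)[]] := HF. Qed.

Lemma unitF x t : F x t \in unitmx.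
Proof. by rewrite unitmxE detF unitr1. Qed.

Lemma det_long_map x tau : \det (long_map x tau) = 1.
Proof. by rewrite det_mulmx detF det_nstep_map// mulr1. Qed.

Lemma genD1 x t : gen (x + 1) t = gen x t.
Proof. by rewrite /gen; have [_ /(_ x)[-> ->]] := HF. Qed.

Lemma gen_le0 x t : t <= 0 -> gen x t = 0.
Proof.
by move=> t0; have [_ _ _ /(_ x t t0)[_ h] _] := HF; rewrite /gen h mul0mx.
Qed.

Lemma gen_ge1 x t : 1 <= t -> gen x t = 0.
Proof.
by move=> t0; have [_ _ _ _ /(_ x t t0)[_ h]] := HF; rewrite /gen h mul0mx.
Qed.

Lemma tr_gen x t : \tr (gen x t) = 0.
Proof.
have [_ _ /(_ x t)[h _] _ _] := HF.
exact: trace_log_derivative (fun u => detF x u) h.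
Qed.

Lemma long_map_int x (n : int) :
  long_map x n%:~R = nstep_map a A n (cpi (2 * x)).
Proof.
rewrite /long_map intrKfloor subrr.
have [_ _ _ h _] := HF; have [-> _] := h (x + n%:~R * b) 0 (lexx 0).
by rewrite mul1mx.
Qed.

(* Near an integer time both neighbouring pieces are visible in one product,  *)
(* since each isotopy is constant outside the unit interval.                  *)
Lemma long_map_local x (n : int) tau : (n - 1)%:~R < tau < (n + 1)%:~R ->
  long_map x tau =
  F (x + n%:~R * b) (tau - n%:~R) *m
  F (x + (n - 1)%:~R * b) (tau - (n - 1)%:~R) *m
  nstep_map a A (n - 1) (cpi (2 * x)).
Proof.
move=> /andP[h1 h2].
have [_ _ _ Fle0 Fge1] := HF.
have [tn|nt] := ltP tau n%:~R.
  rewrite /long_map (@floor_def _ tau (n - 1)); last by rewrite subrK ltW.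
  have [|-> _] := Fle0 (x + n%:~R * b) (tau - n%:~R).
    by rewrite subr_le0 ltW.
  by rewrite mul1mx.
rewrite /long_map (@floor_def _ tau n); last by rewrite nt.
have [|-> _] := Fge1 (x + (n - 1)%:~R * b) (tau - (n - 1)%:~R).
  by rewrite intrD; lra.
rewrite -mulmxA; congr (_ *m _).
rewrite -{1}[n](subrK 1) nstep_mapS// circle_rot_pi; congr (A (cpi _) *m _).
by field.
Qed.

(** In the two-piece product the older isotopy has already run for at least a unit of time, so its
    derivative is zero and only the current piece contributes. *)
Lemma long_map_derivative x tau : mxder (long_map x) tau
  (gen (x + (Num.floor tau)%:~R * b) (tau - (Num.floor tau)%:~R) *m
   long_map x tau).
Proof.
set n := Num.floor tau.
have h1 : (n - 1)%:~R < tau.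
  by rewrite (lt_le_trans _ (floor_le tau))// ltr_int gtrDl.
have h2 : tau < (n + 1)%:~R by exact: floorD1_gt.
have [_ _ hder _ Fge1] := HF.
set N := nstep_map a A (n - 1) (cpi (2 * x)).
apply: (@near_eq_mxder _ _ _ (fun u => F (x + n%:~R * b) (u - n%:~R) *m
    F (x + (n - 1)%:~R * b) (u - (n - 1)%:~R) *m N)).
  near=> u; rewrite (@long_map_local x n u)//; apply/andP; split.
    by near: u; exact: lt_nbhsr.
  by near: u; exact: lt_nbhsl.
have d1 := mxder_translate (hder (x + n%:~R * b) (tau + - n%:~R)).1.
have d2 := mxder_translate (hder (x + (n - 1)%:~R * b) (tau + - (n - 1)%:~R)).1.
have := mxder_mul (mxder_mul d1 d2) (mxder_cst N tau).
rewrite mulmx0 addr0 (@long_map_local x n tau) ?h1// -/N.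
have [|_ ->] := Fge1 (x + (n - 1)%:~R * b) (tau - (n - 1)%:~R).
  by rewrite intrB opprB addrA addrAC lerDr subr_ge0 floor_le.
by rewrite mulmx0 addr0 /gen !mulmxA mulmxKV// unitF.
Unshelve. all: by end_near. Qed.

(** An orbit starting at height r is part of the one from height 0; dividing by the value at r makes
    it start at the identity. *)
Definition flow_map (X : torus b) (t : R) : 'M[R]_m :=
  long_map (repr (repr X).1) (\val (repr X).2 + t) *m
  invmx (long_map (repr (repr X).1) (\val (repr X).2)).

Definition flow_gen (X : torus b) : 'M[R]_m :=
  gen (repr (repr X).1) (\val (repr X).2).

Lemma torus_reprP (u : cylinder R) : let v := repr (\pi_(torus b) u) in
  [\/ v = u, torus_glue b v u | torus_glue b u v].
Proof.
have /(@eqmodP _ (torus_rel b))/or3P :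
    repr (\pi_(torus b) u) = u %[mod torus b].
  by rewrite reprK.
by case=> [/eqP|h|h]; [constructor 1|constructor 2|constructor 3].
Qed.

(** Distinct glued points have heights 0 and 1, where [gen] vanishes; so the chosen representative
    does not matter. *)
Lemma flow_gen_pi (u : cylinder R) :
  flow_gen (\pi_(torus b) u) = gen (repr u.1) (\val u.2).
Proof.
rewrite /flow_gen; case: (torus_reprP u) => [->//|/and3P[/eqP e1 /eqP e0 _]|
  /and3P[/eqP e1 /eqP e0 _]].
  by rewrite gen_ge1 ?e1// gen_le0// e0.
by rewrite gen_le0 ?e0// gen_ge1// e1.
Qed.

Lemma flow_gen_continuous : continuous flow_gen.
Proof.
apply/quotient_continuous/mxcontE => i j.
rewrite (_ : (fun _ => _) =
    (fun u : cylinder R => gen (repr u.1) (\val u.2) i j)); last first.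
  by apply/funext => u; rewrite /= flow_gen_pi.
apply: (cylinder_continuous (h := fun p => gen p.1 p.2 i j)).
  have [[cF cdF] _ _ _ _] := HF.
  have : mxcont (fun p : R * R => gen p.1 p.2); last by apply.
  by apply: mxcont_mul => //; apply: mxcont_inv => // p; rewrite detF.
by move=> x t /=; rewrite genD1.
Qed.

Lemma flow_map_cocycle : SL_flow_cocycle flow_map.
Proof.
split.
  move=> X t; rewrite det_mulmx det_inv !det_long_map.
  by rewrite invr1 mulr1.
exists flow_gen; split; first exact: flow_gen_continuous.
  by move=> X; exact: tr_gen.
move=> X; split.
  by rewrite /flow_map addr0 mulmxV// unitmxE det_long_map unitr1.
move=> t; apply: mxder_is_derive.
set x := repr (repr X).1; set r := \val (repr X).2.
have -> : flow_gen (susp_flow t X) = gen (x + (Num.floor (r + t))%:~R * b)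
    (r + t - (Num.floor (r + t))%:~R).
  rewrite /susp_flow flow_gen_pi /=.
  rewrite -[(repr X).1]reprK circle_rot_pi.
  have [k ->] := circle_reprP (x + (Num.floor (r + t))%:~R * b).
  by rewrite (periodicz (f := fun x => gen x _) (fun x => genD1 x _)).
have := long_map_derivative x (t + r).
rewrite (addrC t r) => h.
have h' : mxder (fun t => long_map x (t + r)) t
  (gen (x + (Num.floor (r + t))%:~R * b) (r + t - (Num.floor (r + t))%:~R) *m
    long_map x (r + t)).
  by apply: mxder_translate; rewrite addrC.
have := mxder_mul h' (mxder_cst (invmx (long_map x r)) t).
rewrite mulmx0 addr0 -mulmxA.
rewrite (_ : (fun t => _) = flow_map X)//.
by apply/funext => u; rewrite /flow_map addrC.
Qed.

Lemma flow_map_int theta (n : int) :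
  flow_map (base_pt b theta) n%:~R = nstep_map a A n (circle_double theta).
Proof.
have l0 x : long_map x 0 = 1%:M by rewrite (long_map_int x 0).
rewrite /flow_map /base_pt.
have := torus_reprP (theta, itv0); rewrite /=.
move: (repr (\pi_(torus b) (theta, itv0))) => v; case=> [->/=||].
- by rewrite add0r l0 long_map_int invmx1 mulmx1.
(* The representative may be (q, 1) with theta the rotation of q by [b]; then the value is the (n +
   1)-step map at 2q times the inverse of [A] at 2q, the n-step map at 2 theta. *)
- move=> /and3P[/eqP -> _ /eqP /= ->].
  set q := v.1.
  rewrite -(intrD _ 1) (long_map_int _ (1 + n)) (long_map_int _ 1).
  rewrite -/(circle_double q) [1 + n]addrC nstep_mapSr//.
  rewrite (_ : nstep_map a A 1 _ = A (circle_double q)); last first.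
    by rewrite /= mulmx1.
  rewrite mulmxK ?SL_unit//; congr nstep_map.
  rewrite -[q]reprK circle_double_pi !circle_rot_pi circle_double_pi.
  by congr (cpi _); field.
- by move=> /and3P[/= /eqP/esym/eqP]; rewrite oner_eq0.
Qed.

End suspended_cocycle.

Theorem corollary3p5 (R : realType) (d : nat) (d_ge3 : (3 <= d)%N) (alpha : R)
    (A : circle R -> 'M[R]_d) (A_cont : continuous A)
    (A_SL : forall theta : circle R, \det (A theta) = 1) :
  exists Phi : torus (alpha / 2) -> R -> 'M[R]_d,
    SL_flow_cocycle Phi /\
    forall (theta : circle R) (n : int),
      Phi (base_pt (alpha / 2) theta) n%:~R =
      nstep_map alpha A n (circle_double theta).
Proof.
case: d d_ge3 A A_cont A_SL => [|[|[|d]]]// _ A A_cont A_SL.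
have lA : loop (fun x => A (\pi_(circle R) x)).
  split=> [|x|x]; [|by rewrite circle_piD1|by rewrite A_SL].
  apply/mxcontE => x; apply: (@continuous_comp _ _ _ _ A); last exact: A_cont.
  exact: pi_continuous.
have [F [dF HF]] := flat_isotopyP
  (homotopic_isotopic1 (fun x => A_SL _) (homotopic_double1 lA)).
exists (@flow_map _ _ alpha A F); split; first exact: flow_map_cocycle HF.
exact: flow_map_int HF.
Qed.
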